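(* For any $\varphi\in L^1(\mathbb{R}^d)$ with $0\leqslant \varphi\leqslant 1$, the solution $u$ of $$u_t=\Delta u-u+\sum_{k\geqslant 1}q_ku^k,\quad x\in\mathbb{R}^d,\ t>0,\qquad 0\leqslant u\leqslant 1,\qquad u(x,0)=\varphi(x),$$ satisfies, for all $t>0$, $$e^{-(1-q_1)t}(K_t\ast \varphi)(x)\leqslant u(x,t)\leqslant C\,e^{-(1-q_1)t}(K_t\ast \varphi)(x),\quad x\in \mathbb{R}^d,$$ with a constant $C=C(d,p,\|\varphi\|_{L^1(\mathbb{R}^d)})$. Moreover, there exists a positive constant $C_\varphi$ (the total asymptotic mass) such that $$t^{d/2}\,\|e^{t(1-q_1)}u(\cdot, t)- C_\varphi K_t \|_{L^\infty(\mathbb{R}^d)} \rightarrow 0\quad \text{as } t\rightarrow \infty.$$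
   Context: $d\geqslant 1$ is an integer. $(q_k)_{k\geqslant 1}$ is a sequence of nonnegative numbers with $\sum_{k\geqslant 1}q_k=1$ and $1<\sum_{k\geqslant 1}kq_k=q<\infty$ (hence $q_1<1$). $p\geqslant 2$ is the smallest index $k\geqslant 2$ with $q_k\neq 0$. $K_t(x)=(4\pi t)^{-d/2}e^{-|x|^2/(4t)}$ is the heat kernel. ''The solution'' is the unique global mild solution with values in $[0,1]$, i.e. the solution of $u(t)= e^{-t}(K_t\ast\varphi) +\int _0^t e^{-(t-s)}K_{t-s}\ast \big( \sum _{k\geqslant 1} q_ku^k(s)\big)ds$.
   Formalization: The constant $C_\varphi$ is asserted to be nonnegative, and positive only when $\varphi$ is not almost everywhere zero; for $\varphi=0$ the solution vanishes and no positive constant can satisfy the limit. *)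

(* Defs.v *)
From HB Require Import structures.
From mathcomp Require Import all_boot all_order all_algebra.
From mathcomp Require Import all_classical all_reals all_analysis.

Set Implicit Arguments.
Unset Strict Implicit.
Unset Printing Implicit Defensive.

Import Order.TTheory GRing.Theory Num.Theory.
Import numFieldNormedType.Exports.

Local Open Scope classical_set_scope.
Local Open Scope ring_scope.

(* R^d is [d.-tuple R], which the library equips with the sigma-algebra
   generated by the coordinates, i.e. the Borel one.  Lebesgue measure on it is
   not in the library: it is built here by induction on d, as the image of the
   product of the measures on R and R^n under [(a, v) |-> a :: v].
   [lebesgue_tuple_box] characterizes it. *)
Section lebesgue_step.
Context {R : realType} {n : nat}.
Variable mu : {sigma_finite_measure set (n.-tuple R) -> \bar R}.

Definition tuple_cons (z : measurableTypeR R * n.-tuple R) : n.+1.-tuple R :=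
  [the n.+1.-tuple R of z.1 :: z.2].

Definition tuple_uncons (v : n.+1.-tuple R) : measurableTypeR R * n.-tuple R :=
  (thead v, [tuple of behead v]).

Lemma tuple_consK : cancel tuple_cons tuple_uncons.
Proof. by case=> a v; congr pair; apply/val_inj. Qed.

Lemma measurable_tuple_cons : measurable_fun setT tuple_cons.
Proof. exact: (measurable_cons measurable_fst measurable_snd). Qed.

Lemma measurable_tuple_uncons : measurable_fun setT tuple_uncons.
Proof.
apply/measurable_fun_pairP; split; first exact: measurable_tnth.
exact: measurable_behead.
Qed.

Definition lebesgue_step : set (n.+1.-tuple R) -> \bar R :=
  pushforward (@lebesgue_measure R \x mu)%E tuple_cons.

Let pushforward_cons : {measure set (n.+1.-tuple R) -> \bar R} :=
  measure_function_pushforward__canonical__measure_function_Measure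
    (@lebesgue_measure R \x mu)%E measurable_tuple_cons.

Let lebesgue_step0 : lebesgue_step set0 = 0%E.
Proof. exact: (measure0 pushforward_cons). Qed.

Let lebesgue_step_ge0 A : (0 <= lebesgue_step A)%E.
Proof. exact: (measure_ge0 pushforward_cons). Qed.

Let lebesgue_step_sigma_additive : semi_sigma_additive lebesgue_step.
Proof. exact: (@measure_semi_sigma_additive _ _ _ pushforward_cons). Qed.

HB.instance Definition _ := isMeasure.Build _ _ _ lebesgue_step
  lebesgue_step0 lebesgue_step_ge0 lebesgue_step_sigma_additive.

Let lebesgue_step_sigma_finite : sigma_finite setT lebesgue_step.
Proof.
have /sigma_finiteP[F [FT ndF Foo]] := sigma_finiteT (@lebesgue_measure R).
have /sigma_finiteP[G [GT ndG Goo]] := sigma_finiteT mu.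
exists (fun k => tuple_uncons @^-1` (F k `*` G k)).
  rewrite -preimage_bigcup (_ : \bigcup_k _ = setT) ?preimage_setT//.
  apply/seteqP; split=> // -[a v] _.
  have [i _ Fia] : (\bigcup_k F k) a by rewrite -FT.
  have [j _ Gjv] : (\bigcup_k G k) v by rewrite -GT.
  exists (maxn i j) => //; split=> /=.
    by move: a Fia; exact/subsetPset/ndF/leq_maxl.
  by move: v Gjv; exact/subsetPset/ndG/leq_maxr.
move=> k; have [mF Fk] := Foo k; have [mG Gk] := Goo k; split.
  rewrite -[X in measurable X]setTI; apply: measurable_tuple_uncons => //.
  exact: measurableX.
rewrite /lebesgue_step /pushforward -comp_preimage.
rewrite (_ : _ \o _ = id); last by apply/funext => z; exact: tuple_consK.
by rewrite product_measure1E// lte_mul_pinfty// ge0_fin_numE.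
Qed.

HB.instance Definition _ := Measure_isSigmaFinite.Build _ _ _ lebesgue_step
  lebesgue_step_sigma_finite.

End lebesgue_step.

Fixpoint lebesgue_tuple (R : realType) (n : nat) :
    {sigma_finite_measure set (n.-tuple R) -> \bar R} :=
  match n with
  | 0 => [the {sigma_finite_measure set (0.-tuple R) -> \bar R} of
           dirac [tuple]]
  | m.+1 => [the {sigma_finite_measure set (m.+1.-tuple R) -> \bar R} of
           lebesgue_step (lebesgue_tuple R m)]
  end.

Lemma measurable_tuple_box (R : realType) (n : nat) (A : 'I_n -> set R) :
  (forall i, measurable (A i)) ->
  measurable [set v : n.-tuple R | forall i, A i (tnth v i)].
Proof.
move=> mA; rewrite (_ : [set _ | _] =
    \bigcap_(i in [set: 'I_n]) ((@tnth n R ^~ i) @^-1` A i)); last first.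
  by apply/seteqP; split=> v /= H; [move=> i _; exact: H|move=> i; exact: (H i I)].
apply: fin_bigcap_measurable => // i _.
by rewrite -[X in measurable X]setTI; exact: measurable_tnth.
Qed.

Lemma lebesgue_tuple_box (R : realType) (n : nat) (A : 'I_n -> set R) :
  (forall i, measurable (A i)) ->
  lebesgue_tuple R n [set v | forall i, A i (tnth v i)] =
  (\prod_(i < n) lebesgue_measure (A i))%E.
Proof.
elim: n A => [|n IH] A mA.
  by rewrite big_ord0 /= diracE mem_set// => -[].
rewrite big_ord_recl /= /lebesgue_step /pushforward.
rewrite (_ : _ @^-1` _ =
    A ord0 `*` [set v | forall i, A (lift ord0 i) (tnth v i)]); last first.
  apply/seteqP; split=> -[a v] /=.
    move=> H; split=> [|i]; first by have := H ord0; rewrite tnth0.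
    by have := H (lift ord0 i); rewrite tnthS.
  by move=> [Aa Av] i; case: (unliftP ord0 i) => [j|] ->; rewrite ?tnthS ?tnth0.
rewrite product_measure1E; last 2 first.
- exact: mA.
- exact: (@measurable_tuple_box _ _ (fun i => A (lift ord0 i))).
by congr (_ * _)%E; exact: (IH (fun i => A (lift ord0 i))).
Qed.

Section heat.
Context {R : realType} {d : nat}.
Implicit Types (t : R) (x y : d.-tuple R).

Local Notation mu := (lebesgue_tuple R d).

Definition tsub x y : d.-tuple R := [tuple tnth x i - tnth y i | i < d].

Definition sqnorm x : R := \sum_(i < d) tnth x i ^+ 2.

Definition heat_kernel t x : R :=
  (4 * pi * t) `^ (- (d%:R / 2)) * expR (- sqnorm x / (4 * t)).

Definition convolution (f g : d.-tuple R -> R) x : R :=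
  \int[mu]_y (f (tsub x y) * g y).

Definition reaction (q : nat -> R) (v : R) : R :=
  limn (fun n => \sum_(1 <= k < n) q k * v ^+ k).

(* Bochner integrals with values in a function space are rendered pointwise:
   for t > 0 both terms of the integral equation are defined at every x, and the
   equation is required at every x.  Measurability of u on (0, +oo) x R^d is
   what makes the space-time integral meaningful.  The formula K_0 * phi = phi
   is replaced by the initial condition, which holds in L^1, i.e. almost
   everywhere. *)
Definition mild_solution (q : nat -> R) (phi : d.-tuple R -> R)
    (u : R -> d.-tuple R -> R) : Prop :=
  [/\ measurable_fun ([set t : R | 0 < t] `*` [set: d.-tuple R])
        (fun z : R * d.-tuple R => u z.1 z.2),
      (forall t x, 0 < t -> 0 <= u t x <= 1),
      {ae mu, forall x, u 0 x = phi x} &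
      forall t x, 0 < t ->
        u t x = expR (- t) * convolution (heat_kernel t) phi x +
          \int[lebesgue_measure]_(s in `[0, t])
            (expR (- (t - s)) *
             convolution (heat_kernel (t - s)) (fun y => reaction q (u s y)) x)].

End heat.

(* Main.v *)
Require Import Defs.
From mathcomp Require Import all_boot all_order all_algebra.
From mathcomp Require Import all_classical all_reals all_analysis.
From mathcomp Require Import measurable_realfun ess_sup_inf ring lra.

Set Implicit Arguments.
Unset Strict Implicit.
Unset Printing Implicit Defensive.

Import Order.TTheory GRing.Theory Num.Theory.
Import numFieldNormedType.Exports.

Local Open Scope classical_set_scope.
Local Open Scope ring_scope.

(** Write [m = 1 - q 1] and let [P t] be convolution with the heat kernel at
    time [t]. On [0, 1] the reaction term lies between [(1 - m) * v] and
    [(1 - m) * v + m * v ^+ 2] ([branching_law_reaction]), so that the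
    equation is a quadratic perturbation of [u_t = Delta u - m u].

    Comparison. If the reaction term is at most [(1 - m + al s) * u] at time
    [s], then [u t <= expR (- m t + int_0^t al) * P t phi] ([duhamel_upper]):
    the right-hand side satisfies the integral equation of the linear problem,
    and each substitution of [u <= right-hand side + error] into the equation
    halves the error in a weighted norm. In the same way the linear part
    alone gives the lower bound ([duhamel_lower]).

    Upper bound. Since [m * u ^+ 2 = (m * u) * u], bounds on [u] can be fed
    back as rates [al >= m * u]. First [al = m] gives [u <= P t phi], which is
    at most 1/2 after the time [halving_time M / m], with [M] the mass of
    [phi]. From then on [m / 2] is an admissible rate, and [u] decays like
    [expR (- (m / 2) * t)] ([trajectory_half_decay]). Now [m * u] is
    integrable in time, and a third comparison gives the claim
    ([trajectory_upper]). In every step [m] and the time occur only through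
    [m * t], up to [m <= 1], which is why the constant does not see the
    sequence [q].

    Asymptotics. The integral equation may be restarted at any time [b]
    ([duhamel_restart]). Comparison from [b] on, with the exponentially small
    rates now available, places [w t = expR (m * t) * u t] between
    [P (t - b) (w b)] and [expR (C * expR (- m b)) * P (t - b) (w b)]. Hence
    the mass of [w t] is nondecreasing and bounded; its supremum
    [total_mass] is the constant sought, and it is at least [M]. For fixed
    [b], the function [w b] minus its mass times [K_b] has mean zero, and the
    heat flow of such a function is [o(t `^ (- d / 2))] uniformly in space
    ([mean_zero_decay]), while [P (t - b) K_b = K_t]. Letting first [t] and
    then [b] tend to infinity proves convergence to the heat kernel profile
    ([asymptotic_profile]). *)

(** * Integration in product coordinates *)

Section tuple_integral.
Context {R : realType}.

Lemma ge0_integral_lebesgue_tupleS n (f : n.+1.-tuple R -> \bar R) :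
  measurable_fun [set: n.+1.-tuple R] f -> (forall v, 0 <= f v)%E ->
  (\int[lebesgue_tuple R n.+1]_v f v =
   \int[@lebesgue_measure R]_a \int[lebesgue_tuple R n]_w
     f (tuple_cons (a, w)))%E.
Proof.
move=> mf f0.
rewrite (_ : (\int[_]_v f v)%E =
    (\int[pushforward (@lebesgue_measure R \x lebesgue_tuple R n)%E
       tuple_cons]_v f v)%E) //.
rewrite (ge0_integral_pushforward measurable_tuple_cons) //.
rewrite preimage_setT fubini_tonelli1 //.
  exact: measurableT_comp mf measurable_tuple_cons.
by move=> x /=; exact: f0.
Qed.

(** Separates the variables: every Gaussian integral below factors through
    this into one-dimensional ones. *)
Lemma ge0_integral_lebesgue_tuple_prod n (F : 'I_n -> R -> R) (c : 'I_n -> R) :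
  (forall i, measurable_fun setT (F i)) -> (forall i a, 0 <= F i a) ->
  (forall i, (\int[@lebesgue_measure R]_a (F i a)%:E = (c i)%:E)%E) ->
  (\int[lebesgue_tuple R n]_v (\prod_(i < n) F i (tnth v i))%:E =
   (\prod_(i < n) c i)%:E)%E.
Proof.
elim: n F c => [|n IH] F c mF F0 Fc.
  rewrite /= integral_dirac //=.
    by rewrite diracT mul1e !big_ord0.
  by under eq_fun do rewrite big_ord0; exact: measurable_cst.
rewrite ge0_integral_lebesgue_tupleS; last first.
- by move=> v; rewrite lee_fin prodr_ge0.
- apply/measurable_EFinP; apply: measurable_prod => i _.
  exact: measurableT_comp (mF i) (measurable_tnth i).
have H a : (\int[lebesgue_tuple R n]_w
    (\prod_(i < n.+1) F i (tnth (tuple_cons (a, w)) i))%:E =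
    (F ord0 a)%:E * (\prod_(i < n) c (lift ord0 i))%:E)%E.
  rewrite -(IH (fun i => F (lift ord0 i)) (fun i => c (lift ord0 i))) //.
  rewrite -ge0_integralZl_EFin //.
  - apply: eq_integral => w _; rewrite big_ord_recl tnth0 EFinM.
    by congr (_ * (_)%:E)%E; apply: eq_bigr => i _; rewrite tnthS.
  - by move=> w _; rewrite lee_fin prodr_ge0.
  - apply/measurable_EFinP; apply: measurable_prod => i _.
    exact: measurableT_comp (mF _) (measurable_tnth i).
under eq_integral do rewrite H.
rewrite ge0_integralZr // ?Fc ?big_ord_recl ?EFinM //.
- have mE : measurable_fun setT (EFin \o F ord0) by apply/measurable_EFinP;
    exact: mF.
  exact: mE.
- by move=> x _; rewrite lee_fin.
- rewrite lee_fin prodr_ge0 // => i _; rewrite -lee_fin -Fc.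
  by apply: integral_ge0 => a _; rewrite lee_fin.
Qed.

End tuple_integral.

(** * Gaussian integrals and the heat kernel *)

Section gaussian.
Context {R : realType}.
Implicit Types t s a m x y w : R.

Definition heat_kernel1 t a : R :=
  (Num.sqrt (4 * pi * t))^-1 * expR (- a ^+ 2 / (4 * t)).

Lemma heat_kernel1_ge0 t a : 0 <= heat_kernel1 t a.
Proof. by rewrite mulr_ge0 ?invr_ge0 ?sqrtr_ge0 ?expR_ge0. Qed.

Lemma measurable_heat_kernel1 t : measurable_fun setT (heat_kernel1 t).
Proof.
apply: measurable_funM => //; apply: measurableT_comp => //.
apply: measurable_funM => //; apply: measurableT_comp => //.
Qed.

Lemma normal_pdf_heat_kernel1 t m a : 0 < t ->
  normal_pdf m (Num.sqrt (2 * t)) a = heat_kernel1 t (a - m).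
Proof.
move=> t0; have t20 : 0 < 2 * t by lra.
rewrite normal_pdfE ?gt_eqF ?sqrtr_gt0 //.
rewrite /normal_peak /normal_fun sqr_sqrtr ?ltW // /heat_kernel1.
congr ((Num.sqrt _)^-1 * expR (- _ ^+ 2 / _)); by rewrite -mulr_natr; ring.
Qed.

Lemma integral_heat_kernel1 t x : 0 < t ->
  (\int[@lebesgue_measure R]_y (heat_kernel1 t (x - y))%:E = 1%:E)%E.
Proof.
move=> t0; rewrite -(integral_normal_pdf x (Num.sqrt (2 * t))).
apply: eq_integral => y _; rewrite normal_pdf_heat_kernel1 //.
by rewrite /heat_kernel1 -[x - y]opprB sqrrN.
Qed.

(** Completing the square: as a function of [y], the product of two Gaussians
    is a Gaussian, centred at the weighted mean of [x] and [w], times a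
    factor free of [y]. Integrating in [y] yields the Chapman-Kolmogorov
    relation. *)
Lemma heat_kernel1M t s x w y : 0 < t -> 0 < s ->
  heat_kernel1 t (x - y) * heat_kernel1 s (y - w) =
  heat_kernel1 (t + s) (x - w) *
  heat_kernel1 (t * s / (t + s)) (y - (s * x + t * w) / (t + s)).
Proof.
move=> t0 s0; have ts0 : 0 < t + s by lra.
have pi0 : 0 < (pi : R) by exact: pi_gt0.
rewrite /heat_kernel1 mulrACA [RHS]mulrACA -!invfM -!sqrtrM; last 2 first.
- by rewrite !mulr_ge0 // ltW.
- by rewrite !mulr_ge0 // ltW.
rewrite -!expRD; congr ((Num.sqrt _)^-1 * expR _).
  by field; rewrite gt_eqF.
by field; rewrite !gt_eqF.
Qed.

Lemma integral_heat_kernel1M t s x w : 0 < t -> 0 < s ->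
  (\int[@lebesgue_measure R]_y
     (heat_kernel1 t (x - y) * heat_kernel1 s (y - w))%:E =
   (heat_kernel1 (t + s) (x - w))%:E)%E.
Proof.
move=> t0 s0.
have ts0 : 0 < t * s / (t + s) by rewrite divr_gt0 ?mulr_gt0 ?addr_gt0.
under eq_integral => y _.
  rewrite heat_kernel1M // -(normal_pdf_heat_kernel1 _ _ ts0) EFinM; over.
rewrite ge0_integralZl_EFin ?integral_normal_pdf ?mule1 ?heat_kernel1_ge0 //.
- by move=> y _; rewrite lee_fin normal_pdf_ge0.
- by apply/measurable_EFinP; exact: measurable_normal_pdf.
Qed.

Lemma powR_half_sqrt_exp (c : R) d : 0 <= c ->
  c `^ (- (d%:R / 2)) = (Num.sqrt c)^-1 ^+ d.
Proof.
move=> c0.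
by rewrite powRN [_ / 2]mulrC powRrM powR_mulrn ?powR_ge0 // powR12_sqrt //
  exprVn.
Qed.

Lemma heat_kernel_prod d t (x : d.-tuple R) : 0 <= t ->
  heat_kernel t x = \prod_(i < d) heat_kernel1 t (tnth x i).
Proof.
move=> t0; rewrite /heat_kernel powR_half_sqrt_exp; last first.
  by rewrite !mulr_ge0 // ltW // pi_gt0.
rewrite big_split /= prodr_const card_ord; congr (_ * _).
rewrite -expR_sum /sqnorm; congr expR.
by rewrite mulNr mulr_suml -sumrN; apply: eq_bigr => i _; rewrite mulNr.
Qed.

Lemma heat_kernel_tsub d t (x y : d.-tuple R) : 0 <= t ->
  heat_kernel t (tsub x y) = \prod_(i < d) heat_kernel1 t (tnth x i - tnth y i).
Proof.
by move=> t0; rewrite heat_kernel_prod //; apply: eq_bigr => i _;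
  rewrite tnth_mktuple.
Qed.

Lemma heat_kernel_tsubC d t (x y : d.-tuple R) :
  heat_kernel t (tsub x y) = heat_kernel t (tsub y x).
Proof.
rewrite /heat_kernel (_ : sqnorm (tsub x y) = sqnorm (tsub y x)) //.
by apply: eq_bigr => i _; rewrite !tnth_mktuple -sqrrN opprB.
Qed.

Lemma heat_kernel_ge0 d t (x : d.-tuple R) : 0 <= heat_kernel t x.
Proof. by rewrite mulr_ge0 ?powR_ge0 ?expR_ge0. Qed.

Lemma integral_heat_kernel d t (x : d.-tuple R) : 0 < t ->
  (\int[lebesgue_tuple R d]_y (heat_kernel t (tsub x y))%:E = 1%:E)%E.
Proof.
move=> t0.
under eq_integral do rewrite heat_kernel_tsub ?ltW //.
rewrite (@ge0_integral_lebesgue_tuple_prod _ _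
  (fun i a => heat_kernel1 t (tnth x i - a)) (fun=> 1)).
- by rewrite big1.
- move=> i; apply: measurableT_comp; first exact: measurable_heat_kernel1.
  exact: measurable_funB.
- by move=> i a; exact: heat_kernel1_ge0.
- by move=> i; exact: integral_heat_kernel1.
Qed.

Lemma integral_heat_kernelM d t s (x w : d.-tuple R) : 0 < t -> 0 < s ->
  (\int[lebesgue_tuple R d]_y
     (heat_kernel t (tsub x y) * heat_kernel s (tsub y w))%:E =
   (heat_kernel (t + s) (tsub x w))%:E)%E.
Proof.
move=> t0 s0; rewrite heat_kernel_tsub ?addr_ge0 ?ltW //.
under eq_integral do rewrite !heat_kernel_tsub ?ltW // -big_split.
apply: (@ge0_integral_lebesgue_tuple_prod _ _
  (fun i a => heat_kernel1 t (tnth x i - a) * heat_kernel1 s (a - tnth w i))).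
- move=> i; apply: measurable_funM;
    (apply: measurableT_comp; first exact: measurable_heat_kernel1);
    exact: measurable_funB.
- by move=> i a; rewrite mulr_ge0 ?heat_kernel1_ge0.
- by move=> i; exact: integral_heat_kernel1M.
Qed.

Lemma sqnorm_ge0 d (x : d.-tuple R) : 0 <= sqnorm x.
Proof. by apply: sumr_ge0 => i _; exact: sqr_ge0. Qed.

Lemma heat_kernel_le d t (x : d.-tuple R) : 0 < t ->
  heat_kernel t x <= (4 * pi * t) `^ (- (d%:R / 2)).
Proof.
move=> t0; rewrite /heat_kernel ler_piMr ?powR_ge0 // -[leRHS]expR0 ler_expR.
by rewrite mulNr oppr_le0 divr_ge0 ?sqnorm_ge0 // mulr_ge0 // ltW.
Qed.

(** The height of the kernel decays exactly like [t `^ (- d / 2)], and the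
    constant [(4 * pi) `^ (- d / 2)] is at most 1. *)
Lemma heat_peak_scaled_le1 d t : 0 < t ->
  t `^ (d%:R / 2) * (4 * pi * t) `^ (- (d%:R / 2)) <= 1.
Proof.
move=> t0; have pi1 : 1 <= 4 * pi :> R by have := pi_ge2 R; lra.
rewrite powRM ?(ltW t0) ?(le_trans _ pi1) // mulrCA -powRD ?subrr ?powRr0
  ?mulr1; last first.
  by apply/implyP => _; rewrite gt_eqF.
by rewrite -[leRHS](powRr0 (4 * pi)) ler_powR.
Qed.

Lemma heat_kernel_scaled_le d t (x : d.-tuple R) : 0 < t ->
  t `^ (d%:R / 2) * heat_kernel t x <= 1.
Proof.
move=> t0; apply: le_trans (heat_peak_scaled_le1 d t0).
by rewrite ler_wpM2l ?powR_ge0 ?heat_kernel_le.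
Qed.

End gaussian.

(** * The heat semigroup *)

Section heat_flow.
Context {R : realType} {d : nat}.
Local Notation T := (d.-tuple R).
Local Notation mu := (lebesgue_tuple R d).
Implicit Types (t s : R) (x y : T) (f g : T -> R).

Local Notation P t f x := (convolution (heat_kernel t) f x).

(** The solution at a fixed time, its image by the reaction term and the heat
    flow of either all have values in [0, 1]. On such functions all
    convolutions converge, and an inequality between extended integrals can
    be read in [R]. *)
Definition profile f :=
  measurable_fun [set: T] f /\ (forall x, 0 <= f x <= 1).

Lemma profile_ge0 f x : profile f -> 0 <= f x.
Proof. by case=> _ /(_ x) /andP[]. Qed.

Lemma profile_le1 f x : profile f -> f x <= 1.
Proof. by case=> _ /(_ x) /andP[]. Qed.

Lemma measurable_heat_kernel_tsub t x :
  measurable_fun [set: T] (fun y => heat_kernel t (tsub x y)).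
Proof.
apply: measurable_funM => //; apply: measurableT_comp => //.
apply: measurable_funM => //; apply: measurableT_comp => //.
apply: measurable_sum => i; apply: measurable_funX.
under eq_fun do rewrite tnth_mktuple.
by apply: measurable_funB => //; exact: measurable_tnth.
Qed.

Lemma integrable_heat_kernel t x : 0 < t ->
  mu.-integrable setT (fun y => (heat_kernel t (tsub x y))%:E).
Proof.
move=> t0; apply/integrableP; split.
  by apply/measurable_EFinP; exact: measurable_heat_kernel_tsub.
under eq_integral do rewrite gee0_abs ?lee_fin ?heat_kernel_ge0 //.
by rewrite integral_heat_kernel // ltry.
Qed.

Lemma integrable_heat_bounded t x f (c : R) : 0 < t ->
  measurable_fun [set: T] f -> (forall y, `|f y| <= c) ->
  mu.-integrable setT (fun y => (heat_kernel t (tsub x y) * f y)%:E).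
Proof.
move=> t0 mf fc.
apply: (@le_integrable _ _ _ mu setT _ _
  (fun y => (c%:E * (heat_kernel t (tsub x y))%:E)%E)) => //.
- apply/measurable_EFinP; apply: measurable_funM => //.
  exact: measurable_heat_kernel_tsub.
- move=> y _; rewrite -EFinM /= lee_fin !normrM mulrC ler_wpM2r //.
  exact: le_trans (fc y) (ler_norm _).
- by apply: integrableZl => //; exact: integrable_heat_kernel.
Qed.

Lemma integrable_heat_profile t x f : 0 < t -> profile f ->
  mu.-integrable setT (fun y => (heat_kernel t (tsub x y) * f y)%:E).
Proof.
move=> t0 [mf f01]; apply: (@integrable_heat_bounded _ _ _ 1) => // y.
by have /andP[f0 f1] := f01 y; rewrite ger0_norm.
Qed.

Lemma heat_EFin t x f : 0 < t -> profile f ->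
  ((P t f x)%:E = \int[mu]_y (heat_kernel t (tsub x y) * f y)%:E)%E.
Proof.
by move=> t0 pf; rewrite fineK //; apply: integrable_fin_num => //;
  exact: integrable_heat_profile.
Qed.

Lemma heat_affine t x f (a b : R) : 0 < t -> profile f ->
  \int[mu]_y (heat_kernel t (tsub x y) * (a * f y + b)) = a * P t f x + b.
Proof.
move=> t0 pf; rewrite /convolution.
have iK := integrable_heat_kernel x t0.
have iKf := integrable_heat_profile x t0 pf.
under eq_Rintegral => y _.
  rewrite mulrDr mulrCA [X in _ + X]mulrC; over.
rewrite RintegralD //; last 2 first.
- exact: (integrableZl measurableT a iKf).
- exact: (integrableZl measurableT b iK).
rewrite (@RintegralZl _ _ _ mu setT _ a measurableT iKf).
rewrite (@RintegralZl _ _ _ mu setT _ b measurableT iK).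
by rewrite {2}/Rintegral integral_heat_kernel // mulr1.
Qed.

(** Positivity of the kernel and its unit mass in one statement: the constant
    [b] goes through the flow unchanged. Constants carry the error terms of
    the comparison argument. *)
Lemma heat_le_affine t x f g (a b : R) : 0 < t -> profile f -> profile g ->
  (forall y, g y <= a * f y + b) -> P t g x <= a * P t f x + b.
Proof.
move=> t0 pf pg gf; rewrite -heat_affine //; apply: le_Rintegral => //.
- exact: integrable_heat_profile.
- apply: (@integrable_heat_bounded _ _ _ (`|a| + `|b|)) => //.
    by case: pf => mf _; apply: measurable_funD => //; exact: measurable_funM.
  move=> y; rewrite (le_trans (ler_normD _ _)) // lerD2r normrM ler_piMr //.
  by case: pf => _ /(_ y) /andP[f0 f1]; rewrite ger0_norm.
- by move=> y _; rewrite ler_wpM2l // heat_kernel_ge0.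
Qed.

Lemma heat_ge_affine t x f g (a b : R) : 0 < t -> profile f -> profile g ->
  (forall y, a * f y + b <= g y) -> a * P t f x + b <= P t g x.
Proof.
move=> t0 pf pg gf; rewrite -heat_affine //; apply: le_Rintegral => //.
- apply: (@integrable_heat_bounded _ _ _ (`|a| + `|b|)) => //.
    by case: pf => mf _; apply: measurable_funD => //; exact: measurable_funM.
  move=> y; rewrite (le_trans (ler_normD _ _)) // lerD2r normrM ler_piMr //.
  by case: pf => _ /(_ y) /andP[f0 f1]; rewrite ger0_norm.
- exact: integrable_heat_profile.
- by move=> y _; rewrite ler_wpM2l // heat_kernel_ge0.
Qed.

Lemma measurable_before t : measurable [set z : R * T | z.1 < t].
Proof.
have -> : [set z : R * T | z.1 < t] = fst @^-1` `]-oo, t[%classic.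
  by apply/seteqP; split => z; rewrite /= in_itv.
by rewrite -[X in measurable X]setTI; exact: measurable_fst.
Qed.

(** At positive times this is [heat_kernel]; the division by [4 * t] is
    replaced by a power, whose measurability in [t] is immediate. *)
Let hk t x : R := (4 * pi * t) `^ (- (d%:R / 2)) *
  expR (- sqnorm x * (4 * t) `^ (-1)).

Let hkE t x : 0 < t -> hk t x = heat_kernel t x.
Proof. by move=> t0; rewrite /hk powR_inv1 // mulr_ge0 // ltW. Qed.

(** Up to an exponential factor this is the Duhamel integrand as a function
    of time and space: [F] is the reaction term and [t] the final time. *)
Lemma measurable_heat_flow (F : R * T -> R) t :
  measurable_fun setT F -> (forall z, 0 <= F z <= 1) ->
  measurable_fun [set z : R * T | z.1 < t]
    (fun z => P (t - z.1) (fun y => F (z.1, y)) z.2).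
Proof.
move=> mF F01.
pose G (w : (R * T) * T) :=
  (hk (t - w.1.1) (tsub w.1.2 w.2) * F (w.1.1, w.2))%:E.
have mG : measurable_fun [set: (R * T) * T] G.
  apply/measurable_EFinP.
  have m1 : measurable_fun [set: (R * T) * T] (fun w => w.1.1).
    by apply: measurableT_comp => //; exact: measurable_fst.
  have mt : measurable_fun [set: (R * T) * T] (fun w => t - w.1.1).
    exact: measurable_funB.
  apply: measurable_funM; last first.
    apply: measurableT_comp mF _; apply: measurable_fun_pair => //.
  apply: measurable_funM.
    apply: (@measurableT_comp _ _ _ _ _ _ (@powR R ^~ (- (d%:R / 2)))).
      exact: measurable_powR.
    by apply: measurable_funM.
  apply: measurableT_comp => //; apply: measurable_funM.
    apply: measurableT_comp => //.
    apply: measurable_sum => i; apply: measurable_funX.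
    under eq_fun do rewrite tnth_mktuple.
    apply: measurable_funB => //.
      apply: measurableT_comp (measurable_tnth i) _.
      by apply: measurableT_comp => //; exact: measurable_fst.
    apply: measurableT_comp (measurable_tnth i) _.
    exact: measurable_snd.
  apply: (@measurableT_comp _ _ _ _ _ _ (@powR R ^~ (- 1))).
    exact: measurable_powR.
  by apply: measurable_funM.
have G0 w : (0 <= G w)%E.
  rewrite lee_fin !mulr_ge0 ?powR_ge0 ?expR_ge0 //.
  by case/andP : (F01 (w.1.1, w.2)).
have := @measurable_fun_fubini_tonelli_F _ _ _ _ R mu G mG G0.
move=> /(measurableT_comp (fine_measurable measurableT)) mfine.
apply: (@eq_measurable_fun _ _ _ _ _ (fine \o fubini_F mu G)); last first.
  exact: measurable_funTS mfine.
move=> -[s x].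
rewrite inE /= => st; congr fine; apply: eq_integral => y _.
by rewrite /G /= hkE // subr_gt0.
Qed.

Lemma measurable_heat t f : 0 < t -> profile f ->
  measurable_fun [set: T] (fun x => P t f x).
Proof.
move=> t0 [mf f01].
have := @measurable_heat_flow (fun z => f z.2) t
  (measurableT_comp mf measurable_snd) (fun z => f01 z.2).
move=> H.
rewrite (_ : (fun x => P t f x) =
  (fun z : R * T => P (t - z.1) f z.2) \o pair (0 : R)); last first.
  by apply/funext => x /=; rewrite subr0.
apply: (measurable_comp (measurable_before t) _ H (@pair1_measurable _ _ R T
  0)).
by move=> z [x _ <-].
Qed.

Lemma profile_heat t f : 0 < t -> profile f -> profile (fun x => P t f x).
Proof.
move=> t0 pf; split; first exact: measurable_heat.
move=> x; apply/andP; split.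
  have := @heat_ge_affine t x f f 0 0 t0 pf pf; rewrite mul0r addr0; apply.
  by move=> y; rewrite mul0r addr0; case: pf => _ /(_ y) /andP[].
have := @heat_le_affine t x f f 0 1 t0 pf pf; rewrite mul0r add0r; apply.
by move=> y; rewrite mul0r add0r; case: pf => _ /(_ y) /andP[].
Qed.

Lemma measurable_kernel_pair t :
  measurable_fun [set: T * T] (fun z => heat_kernel t (tsub z.1 z.2)).
Proof.
apply: measurable_funM => //; apply: measurableT_comp => //.
apply: measurable_funM => //; apply: measurableT_comp => //.
apply: measurable_sum => i; apply: measurable_funX.
under eq_fun do rewrite tnth_mktuple.
apply: measurable_funB => //; apply: measurableT_comp (measurable_tnth i) _.
  exact: measurable_fst.
exact: measurable_snd.
Qed.

Lemma heat_semigroup t s x f : 0 < t -> 0 < s -> profile f ->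
  P t (fun y => P s f y) x = P (t + s) f x.
Proof.
move=> t0 s0 pf; apply: EFin_inj.
have [mf f01] := pf.
rewrite !heat_EFin ?addr_gt0 //; last exact: profile_heat.
pose G (z : T * T) : \bar R := (heat_kernel t (tsub x z.1) *
  (heat_kernel s (tsub z.1 z.2) * f z.2))%:E.
have G0 z : (0 <= G z)%E.
  by rewrite lee_fin mulr_ge0 ?heat_kernel_ge0 // mulr_ge0 ?heat_kernel_ge0
    ?profile_ge0.
have mG : measurable_fun setT G.
  apply/measurable_EFinP; apply: measurable_funM.
    apply: measurableT_comp (measurable_heat_kernel_tsub t x) _.
    exact: measurable_fst.
  apply: measurable_funM; first exact: measurable_kernel_pair.
  apply: measurableT_comp mf _; exact: measurable_snd.
transitivity (\int[mu]_y \int[mu]_w G (y, w))%E.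
  apply: eq_integral => y _; rewrite EFinM heat_EFin // -ge0_integralZl_EFin
    ?heat_kernel_ge0 //.
    by move=> w _; rewrite lee_fin mulr_ge0 ?heat_kernel_ge0 ?profile_ge0.
  by have /measurable_int := integrable_heat_profile y s0 pf.
rewrite (fubini_tonelli G mG G0); apply: eq_integral => w _.
rewrite EFinM -integral_heat_kernelM // -ge0_integralZr //.
- by apply: eq_integral => y _; rewrite /G /= mulrA.
- apply/measurable_EFinP; apply: measurable_funM.
    exact: measurable_heat_kernel_tsub.
  by under eq_fun do rewrite heat_kernel_tsubC;
    exact: measurable_heat_kernel_tsub.
- by move=> y _; rewrite lee_fin mulr_ge0 ?heat_kernel_ge0.
- by rewrite lee_fin profile_ge0.
Qed.

Lemma heat_mass t f : 0 < t -> profile f ->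
  (\int[mu]_x (P t f x)%:E = \int[mu]_y (f y)%:E)%E.
Proof.
move=> t0 pf; have [mf f01] := pf.
pose G (z : T * T) : \bar R := (heat_kernel t (tsub z.1 z.2) * f z.2)%:E.
have G0 z : (0 <= G z)%E.
  by rewrite lee_fin mulr_ge0 ?heat_kernel_ge0 ?profile_ge0.
have mG : measurable_fun setT G.
  apply/measurable_EFinP; apply: measurable_funM.
    exact: measurable_kernel_pair.
  by apply: measurableT_comp mf _; exact: measurable_snd.
under eq_integral do rewrite heat_EFin //.
rewrite (fubini_tonelli G mG G0); apply: eq_integral => w _.
rewrite /G /=; under eq_integral do rewrite mulrC EFinM heat_kernel_tsubC.
rewrite ge0_integralZl_EFin ?integral_heat_kernel ?mule1 //.
- by move=> y _; rewrite lee_fin heat_kernel_ge0.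
- by apply/measurable_EFinP; exact: measurable_heat_kernel_tsub.
- by rewrite profile_ge0.
Qed.

(** The L^1 - L^oo estimate: the kernel is at most its height. *)
Lemma heat_decay t x f (M : R) : 0 < t -> profile f ->
  (\int[mu]_y (f y)%:E <= M%:E)%E ->
  P t f x <= (4 * pi * t) `^ (- (d%:R / 2)) * M.
Proof.
move=> t0 pf fM; have [mf f01] := pf.
rewrite -lee_fin heat_EFin //.
apply: (@le_trans _ _ (\int[mu]_y (((4 * pi * t) `^ (- (d%:R / 2)))%:E * (f
  y)%:E))%E).
  apply: ge0_le_integral => //.
  - by move=> y _; rewrite lee_fin mulr_ge0 ?heat_kernel_ge0 ?profile_ge0.
  - by have /measurable_int := integrable_heat_profile x t0 pf.
  - by under eq_fun do rewrite -EFinM; apply/measurable_EFinP;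
      exact: measurable_funM.
  - move=> y _; rewrite -EFinM lee_fin ler_wpM2r ?heat_kernel_le //.
    by rewrite profile_ge0.
rewrite ge0_integralZl_EFin ?powR_ge0 //.
- by rewrite EFinM lee_wpmul2l // lee_fin powR_ge0.
- by move=> y _; rewrite lee_fin profile_ge0.
- exact/measurable_EFinP.
Qed.

End heat_flow.

(** * The reaction term *)

Section reaction.
Context {R : realType}.

(** The generating function [f] of the offspring law, seen through its linear
    part [1 - m], where [m] is the rate at which a particle splits into at
    least two, and a quadratic bound on the rest. Since [p >= 2] and [v <=
    1], every power [v ^+ k] with [k >= 2] is at most [v ^+ 2], and the
    remaining weights add up to [m]. *)
Definition branching_law (m : R) (f : R -> R) :=
  [/\ 0 < m <= 1, measurable_fun [set v : R | 0 <= v <= 1] f &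
      forall v, 0 <= v <= 1 ->
        (1 - m) * v <= f v <= (1 - m) * v + m * v ^+ 2].

Lemma branching_law_reaction (q : nat -> R) (p : nat) :
  (forall k, (1 <= k)%N -> 0 <= q k) ->
  (fun n => \sum_(1 <= k < n) q k) @ \oo --> (1 : R) ->
  (2 <= p)%N -> q p != 0 ->
  branching_law (1 - q 1%N) (reaction q).
Proof.
move=> q0 q1 p2 qp.
have nd (c : nat -> R) : (forall k, (1 <= k)%N -> 0 <= c k) ->
    nondecreasing_seq (fun n => \sum_(1 <= k < n) c k).
  move=> c0; apply/nondecreasing_seqP => -[|n]; first by rewrite !big_geq.
  by rewrite [leRHS]big_nat_recr //= lerDl c0.
have S1 n : \sum_(1 <= k < n) q k <= 1.
  rewrite -(cvg_lim _ q1) //; apply: nondecreasing_cvgn_le; first exact: nd.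
  by apply/cvg_ex; exists 1.
(* the weight [q p] is positive and cannot be taken by [q 1] *)
have q1p : q 1%N < 1.
  have qp0 : 0 < q p by rewrite lt_neqAle eq_sym qp q0 // ltnW.
  apply: lt_le_trans (S1 p.+1); rewrite big_nat_recr ?(ltnW p2) //=.
  rewrite big_ltn // -addrA ltrDl ltr_wpDl // big_nat_cond sumr_ge0 // => k.
  by rewrite andbT => /andP[k2 _]; rewrite q0 // ltnW.
have bnd v n : 0 <= v <= 1 -> (2 <= n)%N ->
    q 1%N * v <= \sum_(1 <= k < n) q k * v ^+ k <=
    q 1%N * v + (1 - q 1%N) * v ^+ 2.
  move=> /andP[v0 v1] n2; rewrite big_ltn // expr1 lerDl lerD2l.
  apply/andP; split.
    rewrite big_nat_cond sumr_ge0 // => k; rewrite andbT => /andP[k2 _].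
    by rewrite mulr_ge0 ?exprn_ge0 ?q0 // ltnW.
  apply: (@le_trans _ _ (\sum_(2 <= k < n) q k * v ^+ 2)).
    rewrite !big_nat; apply: ler_sum => k /andP[k2 _].
    by rewrite ler_wpM2l ?ler_wiXn2l // q0 // ltnW.
  rewrite -mulr_suml ler_wpM2r ?sqr_ge0 // lerBrDl.
  by have := S1 n; rewrite big_ltn.
have cv v : 0 <= v <= 1 -> cvgn (fun n => \sum_(1 <= k < n) q k * v ^+ k).
  move=> /andP[v0 v1]; apply: nondecreasing_is_cvgn.
    by apply: nd => k k1; rewrite mulr_ge0 ?q0 ?exprn_ge0.
  exists 1 => _ [n _ <-]; apply: le_trans (S1 n).
  rewrite !big_nat; apply: ler_sum => k /andP[k1 _].
  by rewrite ler_piMr ?q0 // exprn_ile1.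
split; first by rewrite subr_gt0 q1p gerBl q0.
  apply: (@measurable_fun_cvg _ R R [set v : R | 0 <= v <= 1]
    (fun n v => \sum_(1 <= k < n) q k * v ^+ k)).
    move=> n; apply: measurable_sum => k; apply: measurable_funM => //.
  by move=> v v01; exact: cv.
move=> v v01; rewrite subKr; apply/andP; split.
  apply: limr_ge; first exact: cv.
  by exists 2%N => // n /= n2; have /andP[] := bnd v n v01 n2.
apply: limr_le; first exact: cv.
by exists 2%N => // n /= n2; have /andP[] := bnd v n v01 n2.
Qed.

Lemma branching_law_unit m f v : branching_law m f -> 0 <= v <= 1 ->
  0 <= f v <= 1.
Proof.
move=> [/andP[m0 m1] _ fE] /[dup] v01 /andP[v0 v1].
have /andP[f1 f2] := fE v v01; apply/andP; split.
  by apply: le_trans f1; rewrite mulr_ge0 // subr_ge0.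
have mv : 0 <= m * v * (1 - v) by rewrite !mulr_ge0 ?subr_ge0 // ltW.
by apply: (le_trans f2); nra.
Qed.

Lemma measurable_branching d (X : measurableType d) m f (D : set X)
    (g : X -> R) :
  branching_law m f -> measurable_fun D g -> (forall x, D x -> 0 <= g x <= 1) ->
  measurable_fun D (f \o g).
Proof.
move=> [_ mf _] mg g01.
have m01 : measurable [set v : R | 0 <= v <= 1].
  have -> : [set v : R | 0 <= v <= 1] = `[0, 1]%classic.
    by apply/seteqP; split => v; rewrite /= in_itv.
  exact: measurable_itv.
by apply: (measurable_comp m01 _ mf mg) => _ [x Dx <-]; exact: g01.
Qed.

End reaction.

(** * Duhamel's formula and its restart *)

Section duhamel.
Context {R : realType} {d : nat}.
Local Notation T := (d.-tuple R).
Local Notation mu := (lebesgue_tuple R d).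
Local Notation leb := (@lebesgue_measure R).
Implicit Types (t s a b : R) (x y : T) (u : R -> T -> R) (psi : T -> R).

Local Notation P t f x := (convolution (heat_kernel t) f x).

Definition trajectory u :=
  measurable_fun ([set t : R | 0 < t] `*` [set: T])
    (fun z : R * T => u z.1 z.2) /\
  (forall t x, 0 < t -> 0 <= u t x <= 1).

Variables (m : R) (f : R -> R).
Hypothesis blf : branching_law m f.

Definition source u t s x : R :=
  expR (- (t - s)) * P (t - s) (fun y => f (u s y)) x.

(** The mild equation with initial time [a] and data [psi]. It is stated with
    extended integrals so that Tonelli's theorem applies directly, and on an
    open interval because the integrand is meaningless at the end points. *)
Definition duhamel u a psi := forall t x, a < t ->
  ((u t x)%:E = (expR (- (t - a)) * P (t - a) psi x)%:E +
    \int[leb]_(s in `]a, t[) (source u t s x)%:E)%E.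

Lemma measurable_time_strip a b : measurable [set z : R * T | a < z.1 < b].
Proof.
have -> : [set z : R * T | a < z.1 < b] = fst @^-1` `]a, b[%classic.
  by apply/seteqP; split => z; rewrite /= in_itv.
by rewrite -[X in measurable X]setTI; exact: measurable_fst.
Qed.

Lemma measurable_pos_times : measurable ([set t : R | 0 < t] `*` [set: T]).
Proof.
apply: measurableX => //.
have -> : [set t : R | 0 < t] = `]0, +oo[%classic.
  by apply/seteqP; split => z; rewrite /= in_itv /= andbT.
exact: measurable_itv.
Qed.

Lemma profile_trajectory u t : trajectory u -> 0 < t -> profile (u t).
Proof.
move=> [mu_ u01] t0; split; last by move=> x; exact: u01.
apply: (measurable_comp measurable_pos_times _ mu_ (@pair1_measurable _ _ R T
  t)).
by move=> _ [x _ <-].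
Qed.

Lemma profile_branching psi : profile psi -> profile (fun y => f (psi y)).
Proof.
move=> [mp p01]; split; last by move=> x; exact: branching_law_unit blf (p01 x).
by apply: (measurable_branching blf mp) => x _; exact: p01.
Qed.

Lemma measurable_source u t : trajectory u ->
  measurable_fun [set z : R * T | 0 < z.1 < t] (fun z => source u t z.1 z.2).
Proof.
move=> [mu_ u01].
pose F := (fun z : R * T => f (u z.1 z.2)) \_
  ([set t : R | 0 < t] `*` [set: T]).
have mF : measurable_fun [set: R * T] F.
  apply/(measurable_restrictT _ measurable_pos_times).
  by apply: (measurable_branching blf mu_) => z [/= z0 _]; exact: u01.
have F01 z : 0 <= F z <= 1.
  rewrite /F /patch; case: ifPn => [|_]; last by rewrite lexx ler01.
  by rewrite inE => -[/= z0 _]; exact: branching_law_unit blf (u01 _ _ z0).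
have H := measurable_heat_flow (t := t) mF F01.
apply: measurable_funM.
  apply: measurableT_comp => //; apply: measurableT_comp => //.
  by apply: measurable_funB => //; apply: measurable_funTS;
    exact: measurable_fst.
apply: (@eq_measurable_fun _ _ (R * T)%type R [set z | 0 < z.1 < t]
    (fun z => P (t - z.1) (fun y => F (z.1, y)) z.2)).
  move=> z; rewrite inE /= => /andP[z0 zt]; congr convolution; apply/funext =>
    y.
  by rewrite /F /patch mem_set.
apply: measurable_funS (measurable_before t) _ H => z /= /andP[] //.
Qed.

Lemma measurable_source_time u t a x : trajectory u -> 0 <= a ->
  measurable_fun `]a, t[%classic (fun s => (source u t s x)%:E).
Proof.
move=> ou a0; apply/measurable_EFinP.
have mp : measurable_fun `]a, t[%classic (fun s : R => (s, x)).
  exact/measurable_funTS/pair2_measurable.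
apply: (measurable_comp (measurable_time_strip 0 t) _ (measurable_source ou)
  mp).
by move=> z [s /=]; rewrite in_itv /= => /andP[/(le_lt_trans a0) s0 st] <-;
  rewrite /= s0.
Qed.

Lemma source_ge0 u t s x : trajectory u -> 0 < s < t -> 0 <= source u t s x.
Proof.
move=> ou /andP[s0 st]; rewrite mulr_ge0 ?expR_ge0 // profile_ge0 //.
by apply: profile_heat; [rewrite
  subr_gt0|exact/profile_branching/profile_trajectory].
Qed.

Lemma source_le1 u t s x : trajectory u -> 0 < s < t -> source u t s x <= 1.
Proof.
move=> ou /andP[s0 st]; rewrite mulr_ile1 ?expR_ge0 //.
- by rewrite profile_ge0 //; apply: profile_heat;
    [rewrite subr_gt0|exact/profile_branching/profile_trajectory].
- by rewrite -[leRHS]expR0 ler_expR oppr_le0 subr_ge0 ltW.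
- by rewrite profile_le1 //; apply: profile_heat;
    [rewrite subr_gt0|exact/profile_branching/profile_trajectory].
Qed.

(** The flow property: the data at time [b] already contains the source
    emitted on [(a, b)], and propagating that part from [b] to [t] gives, by
    Tonelli and the semigroup law, the same contribution as in the equation
    started at [a]. *)
Lemma duhamel_restart u a b psi :
  trajectory u -> profile psi -> 0 <= a -> a < b ->
  duhamel u a psi -> duhamel u b (u b).
Proof.
move=> ou ppsi a0 ab du t x bt.
have b0 : 0 < b by exact: le_lt_trans ab.
have at_ : a < t by exact: lt_trans bt.
have tb0 : 0 < t - b by rewrite subr_gt0.
have ba0 : 0 < b - a by rewrite subr_gt0.
have pub := profile_trajectory ou b0.
pose c : R := expR (- (t - b)).
pose D : set (R * T) := [set z | a < z.1 < b].
pose g (z : R * T) :=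
  c * (heat_kernel (t - b) (tsub x z.2) * source u b z.1 z.2).
pose G := (EFin \o g) \_ D.
have g0 z : D z -> 0 <= g z.
  move=> /andP[az zb]; rewrite mulr_ge0 ?expR_ge0 // mulr_ge0 ?heat_kernel_ge0
    //.
  by rewrite source_ge0 // zb (le_lt_trans a0).
have G0 z : (0 <= G z)%E by apply: erestrict_ge0 => w Dw; rewrite lee_fin g0.
have mG : measurable_fun [set: R * T] G.
  apply/(measurable_restrictT _ (measurable_time_strip a b));
    apply/measurable_EFinP.
  apply: measurable_funM => //; apply: measurable_funM.
    have := measurableT_comp (@measurable_heat_kernel_tsub R d (t - b) x)
      (@measurable_snd _ _ R T).
    exact: measurable_funTS.
  apply: measurable_funS (measurable_time_strip 0 b) _ (measurable_source ou).
  by move=> z /= /andP[/(le_lt_trans a0) -> ->].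
have GE s y : s \in `]a, b[ -> G (s, y) = (g (s, y))%:E.
  by rewrite in_itv /= => sab; rewrite /G /patch mem_set.
have GN s y : s \notin `]a, b[ -> G (s, y) = 0%E.
  by rewrite in_itv /= => sab; rewrite /G /patch memNset //=; exact/negP.
(* the part of the source before time b, propagated from b to t *)
have early : (\int[mu]_y \int[leb]_s G (s, y) =
    \int[leb]_(s in `]a, b[) (source u t s x)%:E)%E.
  have fub := @fubini_tonelli _ _ (measurableTypeR R) T R leb mu G mG G0.
  rewrite -fub [RHS]integral_mkcond; apply: eq_integral => s _.
  rewrite /patch; case: ifPn => [|sab]; last first.
    rewrite integral0_eq // => y _; apply: GN; apply: contra sab.
    by rewrite inE.
  rewrite inE /= => sab; under eq_integral do rewrite GE //.
  move: sab; rewrite in_itv /= => /andP[/(le_lt_trans a0) s0 sb].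
  have bs0 : 0 < b - s by rewrite subr_gt0.
  have pfs := profile_branching (profile_trajectory ou s0).
  have cE : expR (- (t - s)) = c * expR (- (b - s)).
    by rewrite /c -expRD; congr expR; ring.
  rewrite /source cE (_ : t - s = (t - b) + (b - s)); last by ring.
  rewrite -heat_semigroup // EFinM heat_EFin //; last exact: profile_heat.
  rewrite -ge0_integralZl_EFin ?mulr_ge0 ?expR_ge0 //.
  - by apply: eq_integral => y _; rewrite -EFinM /g /source /=; congr EFin;
      ring.
  - by move=> y _; rewrite lee_fin mulr_ge0 ?heat_kernel_ge0 ?profile_ge0 //;
      exact: profile_heat.
  - by have /measurable_int := integrable_heat_profile x tb0 (profile_heat bs0
      pfs).
(* [K_(t-b)] applied to the equation at time [b] *)
have split_b : (expR (- (t - b)) * P (t - b) (u b) x)%:E =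
    ((expR (- (t - a)) * P (t - a) psi x)%:E +
      \int[leb]_(s in `]a, b[) (source u t s x)%:E)%E.
  rewrite -early EFinM heat_EFin // -ge0_integralZl_EFin ?expR_ge0 //;
    last 2 first.
  - by move=> y _; rewrite lee_fin mulr_ge0 ?heat_kernel_ge0 ?profile_ge0.
  - by have /measurable_int := integrable_heat_profile x tb0 pub.
  transitivity (\int[mu]_y ((expR (- (t - a)))%:E *
      (heat_kernel (t - b) (tsub x y) * P (b - a) psi y)%:E +
      \int[leb]_s G (s, y)))%E.
    apply: eq_integral => y _; rewrite EFinM du // muleDr // muleDr //;
      congr (_ + _)%E.
      rewrite -!EFinM; congr EFin.
      have -> : expR (- (t - a)) = expR (- (t - b)) * expR (- (b - a)).
        by rewrite -expRD; congr expR; ring.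
      ring.
    rewrite muleA -EFinM -ge0_integralZl_EFin //; last 3 first.
    - by move=> s; rewrite /= in_itv /= => /andP[/(le_lt_trans a0) s0 sb];
        rewrite lee_fin source_ge0 // s0.
    - exact: measurable_source_time.
    - by rewrite mulr_ge0 ?expR_ge0 ?heat_kernel_ge0.
    rewrite [LHS]integral_mkcond; apply: eq_integral => s _.
    rewrite /patch; case: ifPn => [|sab]; last first.
      by rewrite GN //; apply: contra sab; rewrite inE.
    by rewrite inE /= => sab; rewrite GE // -EFinM /g -mulrA.
  rewrite ge0_integralD //.
  - congr (_ + _)%E; rewrite ge0_integralZl_EFin ?expR_ge0 //.
    + rewrite -heat_EFin //; last exact: profile_heat.
      have e : t - b + (b - a) = t - a by ring.
      have hs := @heat_semigroup R d (t - b) (b - a) x psi tb0 ba0 ppsi.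
      rewrite e in hs.
      rewrite hs.
      exact/esym/EFinM.
    + by move=> y _; rewrite lee_fin mulr_ge0 ?heat_kernel_ge0 ?profile_ge0 //;
        exact: profile_heat.
    + by have /measurable_int := integrable_heat_profile x tb0 (profile_heat
        ba0 ppsi).
  - move=> y _; rewrite -EFinM lee_fin mulr_ge0 ?expR_ge0 // mulr_ge0
      ?heat_kernel_ge0 ?profile_ge0 //.
    exact: profile_heat.
  - apply/measurable_EFinP; apply: measurable_funM => //.
    have /measurable_int := integrable_heat_profile x tb0 (profile_heat ba0
      ppsi).
    by move/measurable_EFinP.
  - by move=> y _; apply: integral_ge0.
  - exact: (@measurable_fun_fubini_tonelli_G _ _ (measurableTypeR R) T R leb G
      mG G0).
rewrite du // split_b -addeA; congr (_ + _)%E.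
rewrite (_ : `]a, t[%classic = `]a, b] `|` `]b, t[); last first.
  by rewrite -itv_bndbnd_setU // bnd_simp ltW.
rewrite ge0_integral_setU //.
- have mS : measurable_fun `]a, b[%classic (fun s : R => (source u t s x)%:E).
    have mat : measurable (`]a, t[%classic : set R) by exact: measurable_itv.
    have H := @measurable_source_time u t a x ou a0.
    apply: measurable_funS mat _ H.
    by move=> s; rewrite /= !in_itv /= => /andP[-> sb]; rewrite (lt_trans sb).
  by congr (_ + _)%E; rewrite integral_itv_bndo_bndc.
- rewrite -itv_bndbnd_setU ?bnd_simp ?ltW //; exact: measurable_source_time.
- rewrite -itv_bndbnd_setU ?bnd_simp ?ltW // => s; rewrite /= in_itv /= =>
    /andP[/(le_lt_trans a0) s0 st].
  by rewrite lee_fin source_ge0 // s0.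
- apply/disj_setPS => s [/=]; rewrite !in_itv /= => /andP[_ sb] /andP[bs _].
  by move: sb; rewrite leNgt bs.
Qed.

End duhamel.

(** * Time integrals bounded by primitives *)

Section primitive.
Context {R : realType}.
Local Notation leb := (@lebesgue_measure R).
Implicit Types (a t s : R) (h H : R -> R).

Lemma is_derive_expR_comp (g : R -> R) (s dg : R) : is_derive s 1 g dg ->
  is_derive s 1 (fun s => expR (g s)) (dg * expR (g s)).
Proof.
by move=> gd; have := is_derive1_comp (is_derive_expR (g s)) gd; rewrite mulrC.
Qed.

Lemma integral_primitive a t H (H' : R -> R) : a < t ->
  (forall s, is_derive s 1 H (H' s)) -> continuous H' ->
  (\int[leb]_(s in `]a, t[) (H' s)%:E = (H t - H a)%:E)%E.
Proof.
move=> at_ dH cH'.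
have cH : continuous H.
  by move=> s; apply/differentiable_continuous/derivable1_diffP;
    have [] := dH s.
rewrite -(@integral_itv_bndoo _ a t _ true false); last first.
  apply/measurable_EFinP; apply: measurable_funTS.
  exact: continuous_measurable_fun.
apply: (@continuous_FTC2 _ H' H a t at_).
- exact: continuous_subspaceT.
- split => [s _||]; first by have [] := dH s.
    exact: cvg_at_right_filter (cH a).
  exact: cvg_at_left_filter (cH t).
- by move=> s _; rewrite derive1E; have := dH s => -[].
Qed.

Lemma integrable_continuous_itv a t (H' : R -> R) : continuous H' ->
  leb.-integrable `]a, t[ (EFin \o H').
Proof.
move=> cH'; apply: (@integrableS _ _ _ leb `[a, t]%classic) => //.
  exact: subset_itv_oo_cc.
by apply: continuous_compact_integrable; [exact: segment_compact|exact:
  continuous_subspaceT].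
Qed.

Lemma integrable_unit_itv a t h : measurable_fun `]a, t[%classic (EFin \o h) ->
  (forall s, a < s < t -> 0 <= h s <= 1) ->
  leb.-integrable `]a, t[ (EFin \o h).
Proof.
move=> mh h01.
apply: (@le_integrable _ _ _ leb `]a, t[%classic _ _ (EFin \o cst 1)) => //.
  move=> s /=; rewrite in_itv /= => /h01 /andP[h0 h1].
  by rewrite lee_fin normr1 ger0_norm.
by apply: integrable_continuous_itv => s; exact: cvg_cst.
Qed.

(** The upper bound [H'] is integrated by the fundamental theorem of
    calculus, so the comparison argument needs no integral beyond explicit
    primitives. *)
Lemma integral_le_primitive a t h H (H' : R -> R) : a < t ->
  measurable_fun `]a, t[%classic (EFin \o h) ->
  (forall s, a < s < t -> 0 <= h s <= 1) ->
  (forall s, is_derive s 1 H (H' s)) -> continuous H' ->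
  (forall s, a < s < t -> h s <= H' s) ->
  (\int[leb]_(s in `]a, t[) (h s)%:E <= (H t - H a)%:E)%E.
Proof.
move=> at_ mh h01 dH cH' hH; rewrite -(integral_primitive at_ dH cH').
apply: le_integral => //.
- exact: integrable_unit_itv.
- exact: integrable_continuous_itv.
- by move=> s; rewrite inE /= in_itv /= => sat; rewrite lee_fin hH.
Qed.

Lemma integral_ge_primitive a t h H (H' : R -> R) : a < t ->
  measurable_fun `]a, t[%classic (EFin \o h) ->
  (forall s, a < s < t -> 0 <= h s <= 1) ->
  (forall s, is_derive s 1 H (H' s)) -> continuous H' ->
  (forall s, a < s < t -> H' s <= h s) ->
  ((H t - H a)%:E <= \int[leb]_(s in `]a, t[) (h s)%:E)%E.
Proof.
move=> at_ mh h01 dH cH' hH; rewrite -(integral_primitive at_ dH cH').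
apply: le_integral => //.
- exact: integrable_continuous_itv.
- exact: integrable_unit_itv.
- by move=> s; rewrite inE /= in_itv /= => sat; rewrite lee_fin hH.
Qed.

End primitive.

(** * Growth rates *)

Section growth.
Context {R : realType}.
Implicit Types (a s r l k : R).

(** Closes the comparison argument, where each use of the integral equation
    halves the error term. *)
Lemma geometric_error (x y k : R) :
  (forall n, x <= y + 2^-1 ^+ n * k) -> x <= y.
Proof.
move=> xy; have half1 : `|2^-1 : R| < 1 by rewrite ger0_norm; lra.
have cv : (fun n => y + 2^-1 ^+ n * k) @ \oo --> y.
  rewrite -[X in _ --> X]addr0 -[X in _ --> _ + X](mul0r k).
  by apply: cvgD; [exact: cvg_cst|apply: cvgM;
    [exact: cvg_expr|exact: cvg_cst]].
by apply: (cvgr_to_ge cv); apply: nearW.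
Qed.

Lemma is_derive_lin2 (p k : R) (g h : R -> R) s dg dh :
  is_derive s 1 g dg -> is_derive s 1 h dh ->
  is_derive s 1 (fun s => p * g s + k * h s) (p * dg + k * dh).
Proof.
by move=> Dg Dh; exact: (is_deriveD (is_deriveZ p Dg) (is_deriveZ k Dh)).
Qed.

Lemma is_derive_subc (g : R -> R) c s dg :
  is_derive s 1 g dg -> is_derive s 1 (fun s => g s - c) dg.
Proof.
by move=> Dg; have := is_deriveB Dg (is_derive_cst c s 1); rewrite subr0.
Qed.

Lemma is_derive_continuous_at (g : R -> R) s dg :
  is_derive s 1 g dg -> g @ s --> g s.
Proof.
by move=> Dg; apply/differentiable_continuous/derivable1_diffP; case: Dg.
Qed.

Variables (A al : R -> R).
Hypotheses (dA : forall s, is_derive s 1 A (al s)) (cal : continuous al).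

(** Primitives of the bounds on the Duhamel integrand: the first exponential
    carries the comparison function, where [A] is a primitive of the excess
    growth rate, and the second carries the error. *)
Definition two_exp a r l k1 k2 s : R :=
  k1 * expR (r * (s - a) + 1 * (A s - A a)) + k2 * expR (l * (s - a)).

Definition two_exp' a r l k1 k2 s : R :=
  k1 * ((r * 1 + 1 * al s) * expR (r * (s - a) + 1 * (A s - A a))) +
  k2 * (l * 1 * expR (l * (s - a))).

Let is_derive_rate a r s :
  is_derive s 1 (fun s => r * (s - a) + 1 * (A s - A a)) (r * 1 + 1 * al s).
Proof.
exact: (is_derive_lin2 _ _ (is_derive_subc a (is_derive_id s 1))
  (is_derive_subc (A a) (dA s))).
Qed.

Let is_derive_linear_rate a l s :
  is_derive s 1 (fun s => l * (s - a)) (l * 1).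
Proof. exact: (is_deriveZ l (is_derive_subc a (is_derive_id s 1))). Qed.

Lemma is_derive_two_exp a r l k1 k2 s :
  is_derive s 1 (two_exp a r l k1 k2) (two_exp' a r l k1 k2 s).
Proof.
exact: (is_derive_lin2 _ _ (is_derive_expR_comp (is_derive_rate a r s))
  (is_derive_expR_comp (is_derive_linear_rate a l s))).
Qed.

Lemma continuous_two_exp' a r l k1 k2 : continuous (two_exp' a r l k1 k2).
Proof.
move=> s; apply: cvgD; apply: cvgM; (try exact: cvg_cst); apply: cvgM.
- apply: cvgD; first exact: cvg_cst.
  by apply: cvgM; [exact: cvg_cst|exact: cal].
- exact: is_derive_continuous_at (is_derive_expR_comp (is_derive_rate a r s)).
- exact: cvg_cst.
- exact: is_derive_continuous_at (is_derive_expR_comp (is_derive_linear_rate a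
    l s)).
Qed.

End growth.

(** * Comparison with the linear equation *)

Section comparison.
Context {R : realType} {d : nat}.
Local Notation T := (d.-tuple R).
Local Notation mu := (lebesgue_tuple R d).
Local Notation leb := (@lebesgue_measure R).
Implicit Types (t s a b : R) (x y : T) (psi : T -> R).

Local Notation P t f x := (convolution (heat_kernel t) f x).

Lemma mild_solution_duhamel m q (phi : T -> R) u :
  branching_law m (reaction q) -> mild_solution q phi u ->
  trajectory u /\ duhamel (reaction q) u 0 phi.
Proof.
move=> bl [mu_ u01 _ uE]; have ou : trajectory u by [].
split=> // t x t0; rewrite uE // EFinD subr0; congr (_ + _)%E.
have mS := measurable_source_time bl (t := t) x ou (lexx 0).
have iS : leb.-integrable `]0, t[ (fun s => (source (reaction q) u t s x)%:E).
  apply: (@integrable_unit_itv R 0 t (fun s => source (reaction q) u t s x)) =>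
    //.
  by move=> s st; rewrite (source_ge0 bl) // (source_le1 bl).
transitivity (fine (\int[leb]_(s in `]0, t[) (source (reaction q) u t s
  x)%:E))%:E.
  by congr (_%:E); rewrite /Rintegral -(@integral_itv_bndoo _ 0 t _ true false).
by rewrite fineK //; exact: integrable_fin_num.
Qed.

Variables (m : R) (f : R -> R) (u : R -> T -> R) (a : R) (psi : T -> R).
Hypotheses (blf : branching_law m f) (ou : trajectory u) (ppsi : profile psi)
  (a0 : 0 <= a) (du : duhamel f u a psi).

(** An affine bound of the solution by the heat flow of the data becomes, by
    the semigroup law, a bound on the integrand in which only the flow at the
    final time occurs. *)
Lemma source_le t s x (c b1 b2 : R) : a < s < t -> 0 <= c ->
  (forall y, f (u s y) <= c * u s y) ->
  (forall y, u s y <= b1 * P (s - a) psi y + b2) ->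
  source f u t s x <= expR (- (t - s)) * (c * (b1 * P (t - a) psi x + b2)).
Proof.
move=> /andP[as_ st] c0 fc ub; rewrite ler_wpM2l ?expR_ge0 //.
have s0 : 0 < s by exact: le_lt_trans as_.
have ts0 : 0 < t - s by rewrite subr_gt0.
have sa0 : 0 < s - a by rewrite subr_gt0.
have e : t - s + (s - a) = t - a by ring.
have hs := @heat_semigroup R d (t - s) (s - a) x psi ts0 sa0 ppsi.
rewrite e in hs.
rewrite mulrDr mulrA -hs; apply: heat_le_affine => //.
- exact: profile_heat.
- exact: (profile_branching blf (profile_trajectory ou s0)).
- move=> y; apply: (le_trans (fc y)).
  by rewrite -mulrA -mulrDr ler_wpM2l.
Qed.

Lemma source_ge t s x (c b1 b2 : R) : a < s < t -> 0 <= c ->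
  (forall y, c * u s y <= f (u s y)) ->
  (forall y, b1 * P (s - a) psi y + b2 <= u s y) ->
  expR (- (t - s)) * (c * (b1 * P (t - a) psi x + b2)) <= source f u t s x.
Proof.
move=> /andP[as_ st] c0 fc ub; rewrite ler_wpM2l ?expR_ge0 //.
have s0 : 0 < s by exact: le_lt_trans as_.
have ts0 : 0 < t - s by rewrite subr_gt0.
have sa0 : 0 < s - a by rewrite subr_gt0.
have e : t - s + (s - a) = t - a by ring.
have hs := @heat_semigroup R d (t - s) (s - a) x psi ts0 sa0 ppsi.
rewrite e in hs.
rewrite mulrDr mulrA -hs; apply: heat_ge_affine => //.
- exact: profile_heat.
- exact: (profile_branching blf (profile_trajectory ou s0)).
- move=> y; apply: le_trans (fc y).
  by rewrite -mulrA -mulrDr ler_wpM2l.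
Qed.

(** A Gronwall lemma. The right-hand side solves the linear equation with
    rate [1 - m + al]; inserting [u <= right-hand side + error] into the
    integral equation reproduces the first term exactly and, thanks to the
    weight [expR (l * t)], halves the error. The first error is 1, since [u
    <= 1]. *)
Lemma duhamel_upper (A al : R -> R) (be : R) :
  (forall s, is_derive s 1 A (al s)) -> continuous al ->
  (forall s, a < s -> 0 <= al s <= be) ->
  (forall s y, a < s -> f (u s y) <= (1 - m + al s) * u s y) ->
  forall t x, a < t ->
    u t x <= expR (- (m * (t - a)) + (A t - A a)) * P (t - a) psi x.
Proof.
move=> dA cal albe fal.
have [/andP[m0 m1] _ _] := blf.
have al0 : 0 <= be.
  have /albe/andP[al0 /(le_trans al0)] : a < a + 1 by rewrite ltrDl.
  by [].
(* twice the largest rate: the weight of the error then gains a factor 1/2 *)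
pose l := 2 * (1 - m + be).
have l0 : 0 <= l by rewrite /l; lra.
pose W t x := expR (- (m * (t - a)) + (A t - A a)) * P (t - a) psi x.
have iter n t x : a < t -> u t x <= W t x + 2^-1 ^+ n * expR (l * (t - a)).
  elim: n t x => [|n IH] t x at_.
    have t0 : 0 < t by exact: le_lt_trans at_.
    rewrite expr0 mul1r (@le_trans _ _ 1) //; first by rewrite profile_le1 //;
      exact: profile_trajectory.
    rewrite ler_wpDl //.
      by rewrite mulr_ge0 ?expR_ge0 // profile_ge0 //; apply: profile_heat;
        rewrite ?subr_gt0.
    by rewrite -[leLHS]expR0 ler_expR mulr_ge0 // subr_ge0 ltW.
  pose p := P (t - a) psi x.
  have p0 : 0 <= p by rewrite profile_ge0 //; apply: profile_heat;
    rewrite ?subr_gt0.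
  pose c0 : R := expR (- (t - a)).
  pose H := two_exp A a (1 - m) (l + 1) (c0 * p) (c0 * 2^-1 ^+ n.+1).
  have key : (\int[leb]_(s in `]a, t[) (source f u t s x)%:E <=
      (H t - H a)%:E)%E.
    have dH := is_derive_two_exp dA a (1 - m) (l + 1) (c0 * p) (c0 * 2^-1 ^+
      n.+1).
    have cH : continuous (two_exp' A al a (1 - m) (l + 1) (c0 * p)
        (c0 * 2^-1 ^+ n.+1)).
      exact: continuous_two_exp'.
    apply: (@integral_le_primitive R a t (fun s =>
      source f u t s x) H _ at_ _ _ dH cH).
    - exact: (measurable_source_time blf x ou a0).
    - move=> s /andP[as_ st].
      by rewrite (source_ge0 blf) ?(source_le1 blf) ?st ?(le_lt_trans a0).
    - move=> s /[dup] ast /andP[as_ st]; have /andP[al1 al2] := albe s as_.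
      have c1 : 0 <= 1 - m + al s by lra.
      apply: (le_trans (source_le x ast c1 (fal s ^~ as_) (fun y =>
        IH s y as_))).
      have -> : - (t - s) = - (t - a) + (s - a) by ring.
      rewrite /two_exp' !mulr1 !mul1r (expRD (- (t - a)) (s - a)) -/c0.
      have -> : expR ((1 - m) * (s - a) + (A s - A a)) =
          expR (s - a) * expR (- (m * (s - a)) + (A s - A a)).
        by rewrite -expRD; congr expR; ring.
      have -> : expR ((l + 1) * (s - a)) = expR (s - a) * expR (l * (s - a)).
        by rewrite -expRD; congr expR; ring.
      rewrite -/p exprS.
      set X := expR (s - a); set Y := expR _; set Z := expR _;
        set q := 2^-1 ^+ n.
      have : 0 <= c0 * X * Z * q * ((l + 1) / 2 - (1 - m + al s)).
        rewrite mulr_ge0 //; last by rewrite /l; lra.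
        by rewrite !mulr_ge0 ?expR_ge0 ?exprn_ge0 ?invr_ge0.
      set w := 1 - m + al s.
      move=> gap; rewrite -subr_ge0; apply: (le_trans gap).
      by rewrite le_eqVlt; apply/orP; left; apply/eqP; field.
  rewrite -lee_fin du //.
  apply: (le_trans (leeD2l _ key)); rewrite -EFinD lee_fin /H /W -/p -/c0.
  rewrite /two_exp !subrr !mulr0 addr0 expR0 !mulr1 mul1r.
  have -> : expR (- (m * (t - a)) + (A t - A a)) =
      c0 * expR ((1 - m) * (t - a) + (A t - A a)).
    by rewrite -expRD; congr expR; ring.
  have -> : expR (l * (t - a)) = c0 * expR ((l + 1) * (t - a)).
    by rewrite -expRD; congr expR; ring.
  have q0 : 0 <= c0 * 2^-1 ^+ n.+1 by rewrite mulr_ge0 ?expR_ge0 ?exprn_ge0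
    ?invr_ge0.
  set X := expR _; set Y := expR _; nra.
move=> t x at_; apply: (@geometric_error _ _ _ (expR (l * (t - a)))) => n.
exact: iter.
Qed.

(** The same iteration from below, with the linear part of the reaction
    alone; the weight [expR t] suffices because the rate [1 - m] is less than
    1. *)
Lemma duhamel_lower t x : a < t ->
  expR (- (m * (t - a))) * P (t - a) psi x <= u t x.
Proof.
have [/andP[m0 m1] _ fE] := blf.
have dZ s : is_derive s 1 (cst 0 : R -> R) (cst 0 s : R) by exact:
  is_derive_cst.
have cZ : continuous (cst 0 : R -> R) by move=> s; exact: cvg_cst.
pose W t x := expR (- (m * (t - a))) * P (t - a) psi x.
have iter n t1 x1 : a < t1 ->
    W t1 x1 + - (2^-1 ^+ n * expR (t1 - a)) <= u t1 x1.
  elim: n t1 x1 => [|n IH] {}t {}x at_.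
    have t0 : 0 < t by exact: le_lt_trans at_.
    rewrite expr0 mul1r (@le_trans _ _ 0) //; last by rewrite profile_ge0 //;
      exact: profile_trajectory.
    rewrite subr_le0 (@le_trans _ _ 1) //.
      rewrite mulr_ile1 ?expR_ge0 //.
      + by rewrite profile_ge0 //; apply: profile_heat; rewrite ?subr_gt0.
      + by rewrite -[leRHS]expR0 ler_expR oppr_le0 mulr_ge0 ?subr_ge0 // ltW.
      + by rewrite profile_le1 //; apply: profile_heat; rewrite ?subr_gt0.
    by rewrite -[leLHS]expR0 ler_expR subr_ge0 ltW.
  pose p := P (t - a) psi x.
  have p0 : 0 <= p by rewrite profile_ge0 //; apply: profile_heat;
    rewrite ?subr_gt0.
  pose c0 : R := expR (- (t - a)).
  pose H := two_exp (cst 0) a (1 - m) 2 (c0 * p) (- (c0 * 2^-1 ^+ n.+1)).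
  have key : ((H t - H a)%:E <=
      \int[leb]_(s in `]a, t[) (source f u t s x)%:E)%E.
    have dH := is_derive_two_exp dZ a (1 - m) 2 (c0 * p) (- (c0 * 2^-1 ^+
      n.+1)).
    have cH : continuous (two_exp' (cst 0) (cst 0) a (1 - m) 2 (c0 * p)
        (- (c0 * 2^-1 ^+ n.+1))).
      exact: continuous_two_exp'.
    apply: (@integral_ge_primitive R a t (fun s =>
      source f u t s x) H _ at_ _ _ dH cH).
    - exact: (measurable_source_time blf x ou a0).
    - move=> s /andP[as_ st].
      by rewrite (source_ge0 blf) ?(source_le1 blf) ?st ?(le_lt_trans a0).
    - move=> s /[dup] ast /andP[as_ st].
      have s0 : 0 < s by exact: le_lt_trans as_.
      have c1 : 0 <= 1 - m by lra.
      have fc y : (1 - m) * u s y <= f (u s y).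
        by case: ou => _ /(_ s y s0) /fE /andP[].
      apply: le_trans (source_ge x ast c1 fc (fun y => IH s y as_)).
      have -> : - (t - s) = - (t - a) + (s - a) by ring.
      rewrite /two_exp' !mulr1 !mul1r (expRD (- (t - a)) (s - a)) -/c0 !subrr
        !addr0.
      have -> : expR ((1 - m) * (s - a)) = expR (s - a) * expR (- (m * (s -
        a))).
        by rewrite -expRD; congr expR; ring.
      have -> : expR (2 * (s - a)) = expR (s - a) * expR (s - a).
        by rewrite -expRD; congr expR; ring.
      rewrite -/p exprS.
      set X := expR (s - a); set Y := expR _; set q := 2^-1 ^+ n.
      have : 0 <= c0 * X * X * q * m.
        by rewrite !mulr_ge0 ?expR_ge0 ?exprn_ge0 ?invr_ge0 // ltW.
      move=> gap; rewrite -subr_ge0; apply: (le_trans gap).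
      by rewrite le_eqVlt; apply/orP; left; apply/eqP; field.
  rewrite -lee_fin du //.
  apply: le_trans (leeD2l _ key); rewrite -EFinD lee_fin /H /W -/p -/c0.
  rewrite /two_exp !subrr !mulr0 !addr0 expR0 !mulr1.
  have -> : expR (- (m * (t - a))) = c0 * expR ((1 - m) * (t - a)).
    by rewrite -expRD; congr expR; ring.
  have -> : expR (2 * (t - a)) = expR (t - a) * expR (t - a).
    by rewrite -expRD; congr expR; ring.
  have -> : c0 = (expR (t - a))^-1 by rewrite -expRN.
  have X0 : 0 < expR (t - a) by exact: expR_gt0.
  have q0 : 0 <= 2^-1 ^+ n.+1 / expR (t - a) :> R.
    by rewrite divr_ge0 ?expR_ge0 ?exprn_ge0 ?invr_ge0.
  rewrite -subr_ge0; apply: (le_trans q0); rewrite le_eqVlt; apply/orP; left;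
    apply/eqP.
  by field; rewrite gt_eqF.
move=> at_; apply: (@geometric_error _ _ _ (expR (t - a))) => n.
by have := iter n t x at_; rewrite lerBlDr.
Qed.

End comparison.

(** * The upper bound with its explicit constant *)

Section upper_bound.
Context {R : realType} {d : nat}.
Local Notation T := (d.-tuple R).
Local Notation mu := (lebesgue_tuple R d).
Implicit Types (t s a b : R) (x y : T) (psi : T -> R).

Local Notation P t f x := (convolution (heat_kernel t) f x).

Variables (m : R) (f : R -> R) (u : R -> T -> R).
Hypotheses (blf : branching_law m f) (ou : trajectory u).

(** The comparison lemma for excess rates [c1 + c2 * expR (- r * s)], which
    cover all its uses. A quadratic nonlinearity [m * u ^+ 2] is a linear one
    of rate [m * u]. *)
Lemma duhamel_upper_exp a psi (c1 c2 r : R) :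
  0 <= a -> profile psi -> duhamel f u a psi ->
  0 <= c1 -> 0 <= c2 -> 0 < r ->
  (forall s y, a < s -> m * u s y <= c1 + c2 * expR (- (r * s))) ->
  forall t x, a < t -> u t x <=
    expR (- (m * (t - a)) + (c1 * (t - a) + c2 / r * expR (- (r * a)))) *
    P (t - a) psi x.
Proof.
move=> a0 ppsi du c10 c20 r0 uc t x at_.
have [/andP[m0 m1] _ fE] := blf.
pose A s := c1 * s + (- (c2 / r)) * expR (- r * s).
pose al s := c1 * 1 + (- (c2 / r)) * (- r * 1 * expR (- r * s)).
have dr s : is_derive s 1 (fun s => - r * s) (- r * 1).
  exact: (is_deriveZ (- r) (is_derive_id s 1)).
have dA s : is_derive s 1 A (al s).
  exact: (is_derive_lin2 _ _ (is_derive_id s 1) (is_derive_expR_comp (dr s))).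
have alE s : al s = c1 + c2 * expR (- (r * s)).
  by rewrite /al (mulNr r s); field; rewrite gt_eqF.
have cal : continuous al.
  move=> s; apply: cvgD; first exact: cvg_cst.
  apply: cvgM; first exact: cvg_cst.
  apply: cvgM; first exact: cvg_cst.
  exact: is_derive_continuous_at (is_derive_expR_comp (dr s)).
apply: (le_trans (@duhamel_upper R d m f u a psi blf ou ppsi a0 du A al (c1 +
  c2)
  dA cal _ _ t x at_)).
- move=> s as_; rewrite alE; apply/andP; split.
    by rewrite addr_ge0 // mulr_ge0 // expR_ge0.
  rewrite lerD2l ler_piMr // -[leRHS]expR0 ler_expR oppr_le0 mulr_ge0 ?(ltW r0)
    //.
  by rewrite ltW // (le_lt_trans a0).
- move=> s y as_; have s0 : 0 < s by exact: le_lt_trans as_.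
  have [_ /(_ s y s0) u01] := ou; have /andP[_ fu] := fE _ u01.
  apply: (le_trans fu); rewrite alE (mulrDl (1 - m)) lerD2l expr2 mulrA
    ler_wpM2r ?uc //.
  by case/andP: u01.
apply: ler_wpM2r.
  by rewrite profile_ge0 //; apply: profile_heat; rewrite ?subr_gt0.
rewrite ler_expR lerD2l /A !mulNr.
have : 0 <= c2 / r * expR (- (r * t)) by rewrite mulr_ge0 ?expR_ge0 // divr_ge0
  // ltW.
by lra.
Qed.

Variables (phi : T -> R) (M : R).
Hypotheses (d1 : (1 <= d)%N) (pphi : profile phi) (du : duhamel f u 0 phi)
  (phiM : (\int[mu]_y (phi y)%:E <= M%:E)%E) (M0 : 0 <= M).

Lemma trajectory_le_heat t x : 0 < t -> u t x <= P t phi x.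
Proof.
move=> t0; have [/andP[m0 m1] _ _] := blf.
have := @duhamel_upper_exp 0 phi m 0 1 (lexx 0) pphi du (ltW m0) (lexx 0) ltr01
  _ t x t0.
rewrite !mul0r !addr0 addNr expR0 mul1r !subr0; apply=> s y s0.
by rewrite mul0r addr0 ler_piMr ?(ltW m0) //; case: ou => _ /(_ s y s0) /andP[].
Qed.

(** Chosen so that [M / sqrt (halving_time M) <= 1 / 2]. As [m <= 1], the
    heat flow of the data is at most 1/2 from time [halving_time M / m] on. *)
Definition halving_time (N : R) : R := (1 + 2 * N) ^+ 2.

Lemma heat_le_half s x : halving_time M <= s -> P s phi x <= 2^-1.
Proof.
move=> Ts; have N0 := M0; have pi1 : 1 <= 4 * pi :> R by have := pi_ge2 R; lra.
have T1 : 1 <= halving_time M.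
  by rewrite /halving_time expr2; nra.
have s0 : 0 < s by apply: lt_le_trans Ts; lra.
apply: (le_trans (heat_decay _ s0 pphi phiM)).
have Tb : halving_time M <= 4 * pi * s.
  by apply: (le_trans Ts); rewrite ler_peMl // ltW.
have half : (4 * pi * s) `^ (- (d%:R / 2)) <= (1 + 2 * M)^-1.
  apply: (@le_trans _ _ ((4 * pi * s) `^ (- 2^-1))).
    rewrite ler_powR ?(le_trans T1) // lerN2 ler_peMl ?invr_ge0 //.
    by rewrite ler1n.
  rewrite powRN powR12_sqrt; last by rewrite (le_trans _ Tb) // (le_trans _ T1).
  rewrite lef_pV2 ?posrE ?sqrtr_gt0; [|by apply: lt_le_trans Tb; lra|lra].
  have -> : 1 + 2 * M = Num.sqrt (halving_time M) by rewrite sqrtr_sqr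
    ger0_norm //; lra.
  exact: ler_wsqrtr.
apply: (le_trans (ler_wpM2r M0 half)); rewrite mulrC ler_pdivrMr; lra.
Qed.

(** The exponential of the total excess over [m / 2] of the rate used in the
    next comparison: it accounts for the time before the solution drops below
    1/2. *)
Definition decay_const (N : R) : R := expR (expR (halving_time N) / 2).

(** Before [halving_time M / m] the excess rate is at most [m], afterwards at
    most [m / 2]. The smooth rate [m / 2 * (1 + expR (halving_time M - m *
    s))] dominates both, and its second term has an integral independent of
    [m]. *)
Lemma trajectory_half_decay t x : 0 < t ->
  u t x <= decay_const M * expR (- (m / 2 * t)).
Proof.
move=> t0; have [/andP[m0 m1] _ _] := blf.
have m20 : 0 <= m / 2 by rewrite divr_ge0 // ltW.
have c20 : 0 <= m / 2 * expR (halving_time M) by rewrite mulr_ge0 ?expR_ge0.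
have T0 : 0 <= halving_time M by rewrite sqr_ge0.
apply: (le_trans (@duhamel_upper_exp 0 phi _ _ m (lexx 0) pphi du m20 c20 m0 _
  t x t0)).
  move=> s y s0; have u1 : u s y <= 1 by case: ou => _ /(_ s y s0) /andP[].
  have [msT|Tms] := leP (m * s) (halving_time M).
    have : 1 <= expR (halving_time M) * expR (- (m * s)).
      by rewrite -expRD -[leLHS]expR0 ler_expR subr_ge0.
    by move=> e1; rewrite -mulrA; nra.
  have uh : u s y <= 2^-1.
    apply: (le_trans (trajectory_le_heat y s0)); apply: heat_le_half.
    by apply: (le_trans (ltW Tms)); rewrite ler_piMl // ltW.
  have : 0 <= m / 2 * expR (halving_time M) * expR (- (m * s)).
    by rewrite mulr_ge0 ?expR_ge0.
  by nra.
rewrite !subr0 mulr0 oppr0 expR0 mulr1.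
rewrite (@le_trans _ _ (expR (- (m * t) + (m / 2 * t + m / 2 * expR
  (halving_time M) / m)))) //.
  by rewrite ler_piMr ?expR_ge0 // profile_le1 //; exact: profile_heat.
rewrite /decay_const -expRD ler_expR le_eqVlt; apply/orP; left; apply/eqP.
by field; rewrite gt_eqF.
Qed.

(** With the bound [decay_const * expR (- (m / 2) * s)] the excess rate [m *
    u] has total integral at most [2 * decay_const]: the factor [m] cancels,
    so the constant depends on the mass of the data alone. *)
Definition upper_const (N : R) : R := expR (2 * decay_const N).

Lemma trajectory_upper t x : 0 < t ->
  u t x <= upper_const M * (expR (- (m * t)) * P t phi x).
Proof.
move=> t0; have [/andP[m0 m1] _ _] := blf.
have c20 : 0 <= m * decay_const M by rewrite mulr_ge0 ?expR_ge0 // ltW.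
have m20 : 0 < m / 2 by rewrite divr_gt0.
apply: (le_trans (@duhamel_upper_exp 0 phi 0 _ _ (lexx 0) pphi du (lexx 0) c20
  m20 _ t x t0)).
  by move=> s y s0; rewrite add0r -mulrA ler_wpM2l ?(ltW m0)
    ?trajectory_half_decay.
rewrite !subr0 mul0r add0r mulr0 oppr0 expR0 mulr1 mulrA.
apply: ler_wpM2r; first by rewrite profile_ge0 //; exact: profile_heat.
rewrite /upper_const -expRD ler_expR le_eqVlt; apply/orP; left; apply/eqP.
by field; rewrite gt_eqF.
Qed.

Lemma trajectory_sup_decay t x : 0 < t ->
  u t x <= upper_const M * expR (- (m * t)).
Proof.
move=> t0; apply: (le_trans (trajectory_upper x t0)).
rewrite ler_wpM2l ?expR_ge0 // ler_piMr ?expR_ge0 // profile_le1 //.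
exact: profile_heat.
Qed.

(** After a time [b] the total excess growth still to come is at most
    [upper_const M * expR (- (m * b))], hence small. *)
Lemma restart_upper b t x : 0 < b -> b < t ->
  u t x <= expR (- (m * (t - b)) + upper_const M * expR (- (m * b))) *
    P (t - b) (u b) x.
Proof.
move=> b0 bt; have [/andP[m0 m1] _ _] := blf.
have c20 : 0 <= m * upper_const M by rewrite mulr_ge0 ?expR_ge0 // ltW.
have := @duhamel_upper_exp b (u b) 0 _ _ (ltW b0) (profile_trajectory ou b0)
  (duhamel_restart blf ou pphi (lexx 0) b0 du) (lexx 0) c20 m0 _ t x bt.
rewrite mul0r add0r (_ : m * upper_const M / m = upper_const M); last first.
  by field; rewrite gt_eqF.
apply=> s y bs; rewrite add0r -mulrA ler_wpM2l ?(ltW m0) //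
  trajectory_sup_decay //.
exact: lt_trans bs.
Qed.

Lemma restart_lower b t x : 0 < b -> b < t ->
  expR (- (m * (t - b))) * P (t - b) (u b) x <= u t x.
Proof.
move=> b0 bt; apply: (duhamel_lower blf ou (profile_trajectory ou b0) (ltW b0))
  => //.
exact: (duhamel_restart blf ou pphi (lexx 0) b0 du).
Qed.

End upper_bound.

(** * Decay of the heat flow of mean-zero data *)

Section mean_zero.
Context {R : realType} {d : nat}.
Local Notation T := (d.-tuple R).
Local Notation mu := (lebesgue_tuple R d).
Implicit Types (s : R) (x y : T) (psi : T -> R).

(** From [1 - expR (- z) <= z] and [al * expR (- al) <= 1]. *)
Lemma expRN_sub_le (al be de k : R) : 0 <= al -> 0 <= de -> 0 <= k ->
  be - al <= de * al + k -> expR (- al) - expR (- be) <= de + k.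
Proof.
move=> al0 de0 k0 h.
have X1 : expR (- al) <= 1 by rewrite -[leRHS]expR0 ler_expR oppr_le0.
have X0 := expR_ge0 (- al).
have aX : al * expR (- al) <= 1.
  have := expR_ge1Dx al; rewrite expRN => h1.
  by rewrite ler_pdivrMr ?expR_gt0 // mul1r (le_trans _ h1) // lerDr.
have -> : expR (- be) = expR (- al) * expR (- (be - al)) by rewrite -expRD;
  congr expR; ring.
have := expR_ge1Dx (- (be - al)).
set X := expR (- al) in X1 X0 aX *; set Y := expR _ => h1.
apply: (@le_trans _ _ (X * (be - al))).
  have : X * (1 + - (be - al)) <= X * Y by rewrite ler_wpM2l.
  by rewrite mulrDr mulr1; lra.
apply: (@le_trans _ _ (X * (de * al + k))); first by rewrite ler_wpM2l.
have : de * (al * X) <= de * 1 by rewrite ler_wpM2l.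
have : k * X <= k * 1 by rewrite ler_wpM2l.
by lra.
Qed.

(** Young's inequality: the difference of the two sides is [de * (z - y / de)
    ^+ 2]. *)
Lemma sqrD_le (z y de : R) : 0 < de ->
  (z + y) ^+ 2 <= (1 + de) * z ^+ 2 + (1 + de^-1) * y ^+ 2.
Proof.
move=> de0; rewrite -subr_ge0.
have -> : (1 + de) * z ^+ 2 + (1 + de^-1) * y ^+ 2 - (z + y) ^+ 2 =
    de * (z - y / de) ^+ 2 by field; rewrite gt_eqF.
by rewrite mulr_ge0 ?sqr_ge0 // ltW.
Qed.

Lemma sqnorm_tsub_le x y (de : R) : 0 < de ->
  sqnorm x <= (1 + de) * sqnorm (tsub x y) + (1 + de^-1) * sqnorm y.
Proof.
move=> de0; rewrite /sqnorm !mulr_sumr -big_split /=; apply: ler_sum => i _.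
by rewrite tnth_mktuple; have := sqrD_le (tnth x i - tnth y i) (tnth y i) de0;
  rewrite subrK.
Qed.

Lemma sqnorm_tsub_ge x y (de : R) : 0 < de ->
  sqnorm (tsub x y) <= (1 + de) * sqnorm x + (1 + de^-1) * sqnorm y.
Proof.
move=> de0; rewrite /sqnorm !mulr_sumr -big_split /=; apply: ler_sum => i _.
by rewrite tnth_mktuple; have := sqrD_le (tnth x i) (- tnth y i) de0;
  rewrite sqrrN.
Qed.

(** Uniform in [x], which is where the parameter [de] comes from: a shift by
    [y] changes the exponent by a small fraction of itself plus a multiple of
    [sqnorm y / s]. *)
Lemma gaussian_oscillation s x y (de : R) : 0 < s -> 0 < de ->
  `|expR (- sqnorm (tsub x y) / (4 * s)) - expR (- sqnorm x / (4 * s))| <=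
  de + (1 + de^-1) * sqnorm y / (4 * s).
Proof.
move=> s0 de0; have s40 : 0 < (4 * s)^-1 by rewrite invr_gt0; lra.
have k0 : 0 <= (1 + de^-1) * sqnorm y / (4 * s).
  by rewrite mulr_ge0 ?(ltW s40) // mulr_ge0 ?sqnorm_ge0 // addr_ge0 //
    invr_ge0 ltW.
rewrite !mulNr ler_norml lerNl opprB; apply/andP; split; apply: expRN_sub_le =>
  //;
  try (exact: ltW); try (by rewrite mulr_ge0 ?sqnorm_ge0 // ltW).
- have := ler_wpM2r (ltW s40) (sqnorm_tsub_ge x y de0); lra.
- have := ler_wpM2r (ltW s40) (sqnorm_tsub_le x y de0); lra.
Qed.

Lemma gaussian_oscillation_le1 s x y : 0 < s ->
  `|expR (- sqnorm (tsub x y) / (4 * s)) - expR (- sqnorm x / (4 * s))| <= 1.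
Proof.
move=> s0; have s40 : 0 <= (4 * s)^-1 by rewrite invr_ge0; lra.
have E (z : T) : 0 <= expR (- sqnorm z / (4 * s)) <= 1.
  by rewrite expR_ge0 -[leRHS]expR0 ler_expR mulNr oppr_le0 mulr_ge0
    ?sqnorm_ge0.
have /andP[a0 a1] := E (tsub x y); have /andP[b0 b1] := E x.
by rewrite ler_norml; apply/andP; split; lra.
Qed.

Lemma heat_kernel_oscillation s x y (B : R) : 0 < s ->
  `|expR (- sqnorm (tsub x y) / (4 * s)) - expR (- sqnorm x / (4 * s))| <= B ->
  s `^ (d%:R / 2) * `|heat_kernel s (tsub x y) - heat_kernel s x| <= B.
Proof.
move=> s0 hB; rewrite /heat_kernel -mulrBr normrM mulrA (ger0_norm (powR_ge0 _
  _)).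
apply: le_trans hB; rewrite ler_piMl //.
exact: heat_peak_scaled_le1.
Qed.

Lemma integrable_heat_L1 s x psi : 0 < s -> mu.-integrable setT (EFin \o psi) ->
  mu.-integrable setT (fun y => (heat_kernel s (tsub x y) * psi y)%:E).
Proof.
move=> s0 ipsi; have mpsi : measurable_fun setT psi.
  by have /measurable_int/measurable_EFinP := ipsi.
apply: (@le_integrable _ _ _ mu setT _ _
  (fun y => (((4 * pi * s) `^ (- (d%:R / 2)))%:E * (EFin \o psi) y)%E)) => //.
- apply/measurable_EFinP; apply: measurable_funM => //.
  exact: measurable_heat_kernel_tsub.
- move=> y _; rewrite /= lee_fin !normrM ler_wpM2r //.
  by rewrite !ger0_norm ?heat_kernel_ge0 ?powR_ge0 // heat_kernel_le.
- exact: integrableZl.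
Qed.

(** Replaces the second moment of [psi], which may be infinite. *)
Lemma truncated_moment_small psi (ep : R) : 0 < ep ->
  mu.-integrable setT (EFin \o psi) ->
  exists n : nat, \int[mu]_y (Num.min 1 (sqnorm y / n.+1%:R) * `|psi y|) <= ep.
Proof.
move=> ep0 ipsi; have mpsi : measurable_fun setT psi.
  by have /measurable_int/measurable_EFinP := ipsi.
have msq : measurable_fun [set: T] (@sqnorm R d).
  by apply: measurable_sum => i; apply: measurable_funX; exact: measurable_tnth.
have ge0 n y : 0 <= Num.min 1 (sqnorm y / n.+1%:R) :> R.
  by rewrite le_min ler01 divr_ge0 ?sqnorm_ge0.
pose f_ n y : \bar R := (Num.min 1 (sqnorm y / n.+1%:R) * `|psi y|)%:E.
have mf_ n : measurable_fun [set: T] (f_ n).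
  apply/measurable_EFinP; apply: measurable_funM; last exact: measurableT_comp.
  by apply: measurable_minr => //; apply: measurable_funM.
have bound n y : (`|f_ n y| <= `|psi y|%:E)%E.
  rewrite /f_ /= lee_fin ger0_norm ?mulr_ge0 // ler_piMl //.
  by rewrite ge_min lexx.
have f_0 y : f_ ^~ y @ \oo --> 0%E.
  apply: cvg_EFin; first exact: nearW.
  rewrite -(mul0r `|psi y|); apply: cvgM; last exact: cvg_cst.
  apply: (@squeeze_cvgr _ _ _ _ (fun=> 0) (fun n => sqnorm y * n.+1%:R^-1)).
  - by apply: nearW => n; rewrite ge0 ge_min lexx orbT.
  - exact: cvg_cst.
  - rewrite -[X in _ --> X](mulr0 (sqnorm y)); apply: cvgM;
      first exact: cvg_cst.
    exact: cvg_harmonic.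
have [_ _ cv] := @dominated_convergence _ _ _ mu setT measurableT f_ (cst 0%E)
  (fun y => `|psi y|%:E) mf_ (measurable_cst _)
  (aeW _ (fun y _ => f_0 y)) (integrable_abse ipsi) (aeW _ (fun y n _ =>
    bound n y)).
rewrite integral0 in cv.
have /fine_cvgP[_ cvr] := cv.
move/cvgr_le: cvr => /(_ ep ep0)[n _ hn].
by exists n; exact: (hn n (leqnn n)).
Qed.

(** As the mean vanishes, [K_s (x - y)] may be replaced by the difference
    [K_s (x - y) - K_s x], which is [o(s `^ (- d / 2))] uniformly in [x] for
    each fixed [y]. *)
Lemma mean_zero_decay psi (ep : R) : 0 < ep ->
  mu.-integrable setT (EFin \o psi) -> \int[mu]_y psi y = 0 ->
  exists2 S : R, 0 < S & forall s x, S <= s ->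
    s `^ (d%:R / 2) * `|\int[mu]_y (heat_kernel s (tsub x y) * psi y)| <= ep.
Proof.
move=> ep0 ipsi psi0.
have mpsi : measurable_fun setT psi.
  by have /measurable_int/measurable_EFinP := ipsi.
have iabs : mu.-integrable setT (fun y => `|psi y|%:E).
  exact: integrable_abse ipsi.
pose N := \int[mu]_y `|psi y|.
have N0 : 0 <= N by apply: Rintegral_ge0.
have [n hn] := truncated_moment_small (divr_gt0 ep0 (ltr0n R 2)) ipsi.
(* [de] spends half of [ep] on the L^1 norm; the truncated moment spends the
   rest *)
pose de := ep / (2 * (N + 1)).
have de0 : 0 < de by rewrite divr_gt0 //; lra.
have dei : 0 < de^-1 by rewrite invr_gt0.
pose th y : R := Num.min 1 (sqnorm y / n.+1%:R).
have th0 y : 0 <= th y by rewrite le_min ler01 divr_ge0 ?sqnorm_ge0.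
have ith : mu.-integrable setT (fun y => (th y * `|psi y|)%:E).
  apply: (@le_integrable _ _ _ mu setT _ _ (fun y => `|psi y|%:E)) => //.
    apply/measurable_EFinP; apply: measurable_funM;
      last exact: measurableT_comp.
    apply: measurable_minr => //; apply: measurable_funM => //.
    by apply: measurable_sum => i; apply: measurable_funX;
      exact: measurable_tnth.
  move=> y _; rewrite /= lee_fin normrM !normr_id ler_piMl // ger0_norm //.
  by rewrite ge_min lexx.
exists ((1 + de^-1) * n.+1%:R / 4); first by rewrite divr_gt0 // mulr_gt0 //;
  lra.
move=> s x Ss.
have s0 : 0 < s by apply: lt_le_trans Ss; rewrite divr_gt0 // mulr_gt0 //; lra.
have osc y : s `^ (d%:R / 2) * `|heat_kernel s (tsub x y) - heat_kernel s x| <=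
  de + th y.
  apply: heat_kernel_oscillation => //.
  rewrite /th; case: (leP 1 (sqnorm y / n.+1%:R)) => h1.
    by apply: (le_trans (gaussian_oscillation_le1 x y s0)); lra.
  apply: (le_trans (gaussian_oscillation x y s0 de0)).
  rewrite lerD2l [leLHS]mulrAC mulrC ler_wpM2l ?sqnorm_ge0 //.
  rewrite ler_pdivrMr; last by lra.
  rewrite mulrC ler_pdivlMr; last by rewrite ltr0n.
  by move: Ss; rewrite ler_pdivrMr //; lra.
have iK := integrable_heat_L1 x s0 ipsi.
have iK0 : mu.-integrable setT (fun y => (heat_kernel s x * psi y)%:E).
  exact: (integrableZl measurableT (heat_kernel s x) ipsi).
have -> : \int[mu]_y (heat_kernel s (tsub x y) * psi y) =
    \int[mu]_y ((heat_kernel s (tsub x y) - heat_kernel s x) * psi y).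
  under [RHS]eq_Rintegral do rewrite mulrBl.
  by rewrite RintegralB // (RintegralZl _ measurableT ipsi) psi0 mulr0 subr0.
have idiff : mu.-integrable setT
    (EFin \o (fun y => (heat_kernel s (tsub x y) - heat_kernel s x) * psi y)).
  have := integrableB measurableT iK iK0; apply: eq_integrable => // y _.
  by rewrite /= mulrBl EFinB.
have P0 := powR_ge0 s (d%:R / 2).
apply: (le_trans (ler_wpM2l P0 (le_normr_Rintegral measurableT idiff))).
have iad := integrable_abse idiff.
rewrite -(RintegralZl _ measurableT iad).
apply: (@le_trans _ _ (\int[mu]_y (de * `|psi y| + th y * `|psi y|))).
  apply: le_Rintegral => //.
  - exact: (integrableZl measurableT _ iad).
  - exact: (integrableD measurableT (integrableZl measurableT de iabs) ith).
  - move=> y _; rewrite normrM mulrA -mulrDl ler_wpM2r //; exact: osc.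
rewrite RintegralD //; last exact: (integrableZl measurableT de iabs).
rewrite (RintegralZl _ measurableT iabs) -/N.
have : de * N <= ep / 2.
  by rewrite /de mulrAC ler_pdivrMr; [nra|lra].
by move: hn; rewrite -/th; lra.
Qed.

End mean_zero.

(** * Asymptotic mass and profile *)

Section asymptotics.
Context {R : realType} {d : nat}.
Local Notation T := (d.-tuple R).
Local Notation mu := (lebesgue_tuple R d).
Implicit Types (t s a b : R) (x y : T) (psi : T -> R).

Local Notation P t f x := (convolution (heat_kernel t) f x).

Lemma tsub0 x : tsub x [tuple 0 | i < d] = x.
Proof. by apply: eq_from_tnth => i; rewrite !tnth_mktuple subr0. Qed.

Lemma integrable_profile (g : T -> R) (c : R) : profile g ->
  (\int[mu]_y (g y)%:E <= c%:E)%E -> mu.-integrable setT (EFin \o g).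
Proof.
move=> pg gc; apply/integrableP; split.
  by apply/measurable_EFinP; case: pg.
apply: le_lt_trans (ltry c); apply: le_trans gc.
by rewrite le_eqVlt; apply/orP; left; apply/eqP; apply: eq_integral => y _;
  rewrite /= ger0_norm // profile_ge0.
Qed.

Lemma mass_le_heat (g h : T -> R) (c t : R) :
  0 < t -> 0 <= c -> profile g -> profile h ->
  (forall x, g x <= c * P t h x) ->
  (\int[mu]_y (g y)%:E <= c%:E * \int[mu]_y (h y)%:E)%E.
Proof.
move=> t0 c0 pg ph gh; have pPh := profile_heat t0 ph.
rewrite -(heat_mass t0 ph) -ge0_integralZl_EFin //.
- apply: ge0_le_integral => //.
  + by move=> y _; rewrite lee_fin profile_ge0.
  + by apply/measurable_EFinP; case: pg.
  + under eq_fun do rewrite -EFinM.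
    by apply/measurable_EFinP; apply: measurable_funM => //; case: pPh.
  + by move=> y _; rewrite -EFinM lee_fin.
- by move=> y _; rewrite lee_fin (profile_ge0 _ pPh).
- by apply/measurable_EFinP; case: pPh.
Qed.

Lemma mass_ge_heat (g h : T -> R) (c t : R) :
  0 < t -> 0 <= c -> profile g -> profile h ->
  (forall x, c * P t h x <= g x) ->
  (c%:E * \int[mu]_y (h y)%:E <= \int[mu]_y (g y)%:E)%E.
Proof.
move=> t0 c0 pg ph gh; have pPh := profile_heat t0 ph.
rewrite -(heat_mass t0 ph) -ge0_integralZl_EFin //.
- apply: ge0_le_integral => //.
  + by move=> y _; rewrite -EFinM lee_fin mulr_ge0 // (profile_ge0 _ pPh).
  + under eq_fun do rewrite -EFinM.
    by apply/measurable_EFinP; apply: measurable_funM => //; case: pPh.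
  + by apply/measurable_EFinP; case: pg.
  + by move=> y _; rewrite -EFinM lee_fin.
- by move=> y _; rewrite lee_fin (profile_ge0 _ pPh).
- by apply/measurable_EFinP; case: pPh.
Qed.

Variables (m : R) (f : R -> R) (u : R -> T -> R) (phi : T -> R) (M : R).
Hypotheses (blf : branching_law m f) (ou : trajectory u)
  (d1 : (1 <= d)%N) (pphi : profile phi) (du : duhamel f u 0 phi)
  (phiM : (\int[mu]_y (phi y)%:E = M%:E)%E) (M0 : 0 <= M).

Let phiM' : (\int[mu]_y (phi y)%:E <= M%:E)%E.
Proof. by rewrite phiM. Qed.

Let C := upper_const M.
Let m0 : 0 < m. Proof. by case: blf => /andP[]. Qed.
Let C0 : 0 <= C. Proof. exact: expR_ge0. Qed.

Lemma integral_trajectory_le t : 0 < t ->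
  (\int[mu]_y (u t y)%:E <= (C * expR (- (m * t)) * M)%:E)%E.
Proof.
move=> t0; rewrite EFinM -phiM.
apply: (mass_le_heat t0 _ (profile_trajectory ou t0) pphi).
  by rewrite mulr_ge0 ?expR_ge0.
move=> x; rewrite -mulrA.
exact: (trajectory_upper blf ou d1 pphi du phiM' M0).
Qed.

Lemma integrable_trajectory t : 0 < t -> mu.-integrable setT (EFin \o u t).
Proof.
move=> t0; exact: integrable_profile (profile_trajectory ou t0)
  (integral_trajectory_le t0).
Qed.

(** The mass of [expR (m * t) * u t]: for the linear part of the equation it
    would be constant. *)
Definition scaled_mass t : R := expR (m * t) * \int[mu]_y u t y.

Lemma integral_trajectoryE t : 0 < t ->
  (\int[mu]_y (u t y)%:E = (expR (- (m * t)) * scaled_mass t)%:E)%E.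
Proof.
move=> t0; rewrite /scaled_mass mulrA -expRD addNr expR0 mul1r fineK //.
exact: integrable_fin_num (integrable_trajectory t0).
Qed.

Lemma scaled_mass_le t : 0 < t -> scaled_mass t <= C * M.
Proof.
move=> t0; have := integral_trajectory_le t0.
rewrite integral_trajectoryE // lee_fin mulrAC mulrC ler_pM2r ?expR_gt0 //.
Qed.

Lemma scaled_mass_ge t : 0 < t -> M <= scaled_mass t.
Proof.
move=> t0; have := @mass_ge_heat (u t) phi (expR (- (m * t))) t t0 (expR_ge0 _)
  (profile_trajectory ou t0) pphi.
rewrite phiM integral_trajectoryE // -EFinM lee_fin ler_pM2l ?expR_gt0 //.
apply=> x; have := duhamel_lower blf ou pphi (lexx 0) du x t0.
by rewrite subr0.
Qed.

Lemma scaled_mass_nondecreasing b t : 0 < b -> b < t ->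
  scaled_mass b <= scaled_mass t.
Proof.
move=> b0 bt; have t0 : 0 < t by exact: lt_trans bt.
have tb0 : 0 < t - b by rewrite subr_gt0.
have := @mass_ge_heat (u t) (u b) (expR (- (m * (t - b)))) (t - b) tb0
  (expR_ge0 _)
  (profile_trajectory ou t0) (profile_trajectory ou b0)
  (fun x => restart_lower blf ou pphi du x b0 bt).
rewrite !integral_trajectoryE // -EFinM lee_fin mulrA -expRD.
by rewrite (_ : _ + _ = - (m * t)) ?ler_pM2l ?expR_gt0 //; ring.
Qed.

Lemma scaled_mass_growth b t : 0 < b -> b < t ->
  scaled_mass t <= expR (C * expR (- (m * b))) * scaled_mass b.
Proof.
move=> b0 bt; have t0 : 0 < t by exact: lt_trans bt.
have tb0 : 0 < t - b by rewrite subr_gt0.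
have := @mass_le_heat (u t) (u b) _ (t - b) tb0 (expR_ge0 _)
  (profile_trajectory ou t0) (profile_trajectory ou b0)
  (fun x => restart_upper blf ou d1 pphi du phiM' M0 x b0 bt).
rewrite !integral_trajectoryE // -EFinM lee_fin [leRHS]mulrA.
have e : expR (- (m * (t - b)) + C * expR (- (m * b))) * expR (- (m * b)) =
    expR (- (m * t)) * expR (C * expR (- (m * b))).
  by rewrite -!expRD; congr expR; ring.
by rewrite -/C e -mulrA ler_pM2l ?expR_gt0.
Qed.

(** The scaled mass is nondecreasing and bounded, so its supremum is its
    limit. *)
Definition total_mass : R := sup [set scaled_mass t | t in [set t : R | 0 < t]].

Let mass_set := [set scaled_mass t | t in [set t : R | 0 < t]].

Let mass_ub : has_ubound mass_set.
Proof. by exists (C * M) => _ [t /= t0 <-]; exact: scaled_mass_le. Qed.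

Lemma scaled_mass_le_total t : 0 < t -> scaled_mass t <= total_mass.
Proof. by move=> t0; apply: ub_le_sup => //; exists t. Qed.

Lemma total_mass_ge : M <= total_mass.
Proof.
exact: le_trans (scaled_mass_ge ltr01) (scaled_mass_le_total ltr01).
Qed.

(** The scaled mass after time [t] exceeds its value at [t] by a factor that
    tends to 1. *)
Lemma total_mass_le t : 0 < t ->
  total_mass <= expR (C * expR (- (m * t))) * scaled_mass t.
Proof.
move=> t0; apply: ge_sup; first by exists (scaled_mass 1), 1; rewrite /= ?ltr01.
move=> _ [s /= s0 <-]; apply: (@le_trans _ _ (scaled_mass (s + t))).
  by apply: scaled_mass_nondecreasing => //; rewrite ltrDl.
by apply: scaled_mass_growth => //; rewrite ltrDr.
Qed.

(** The witness comes from [expR z >= z] with [z = m * b]. *)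
Lemma late_time (ep : R) : 0 < ep ->
  exists2 b : R, 0 < b & expR (C * expR (- (m * b))) - 1 <= ep.
Proof.
move=> ep0; have Cgt : 0 < C by exact: expR_gt0.
have l0 : 0 < ln (1 + ep) by rewrite ln_gt0 // ltrDl.
exists (C / (m * ln (1 + ep))); first by rewrite divr_gt0 // mulr_gt0.
rewrite lerBlDl -[leRHS]lnK ?posrE ?addr_gt0 // ler_expR expRN.
rewrite ler_pdivrMr ?expR_gt0 // mulrC -ler_pdivrMr //.
rewrite (_ : m * (C / (m * ln (1 + ep))) = C / ln (1 + ep)); last first.
  by field; rewrite !gt_eqF.
by apply: le_trans (expR_ge1Dx _); rewrite lerDr.
Qed.

(** With [s = t - b], the scaled solution differs from [A = P s] of its value
    at [b] by at most [(ka - 1) * A]; [A] differs from [Mb * K_t] by the flow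
    of the mean-zero function [psi], because [P s K_b = K_t]; and [Mb] is
    close to the total mass. A late [b] controls the first and third errors,
    a later [t] the second. Lengths of time [s] and [t] are comparable, at
    the price of the factor [D]. *)
Lemma asymptotic_profile (ep : R) : 0 < ep ->
  exists2 t0 : R, 0 < t0 & forall t x, t0 <= t ->
    t `^ (d%:R / 2) *
      `|expR (m * t) * u t x - total_mass * heat_kernel t x| <= ep.
Proof.
move=> ep0.
pose D : R := 2 `^ (d%:R / 2).
have D0 : 0 < D by rewrite powR_gt0.
have CM0 : 0 <= C * M by rewrite mulr_ge0.
pose e1 : R := ep / (2 * (D * (C * M) + C * M + 1)).
have den0 : 0 < 2 * (D * (C * M) + C * M + 1).
  have : 0 <= D * (C * M) by rewrite mulr_ge0 // ltW.
  lra.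
have e10 : 0 < e1 by rewrite divr_gt0.
have [b b0 be] := late_time e10.
set ka := expR (C * expR (- (m * b))) in be.
have ka1 : 1 <= ka by rewrite -[leLHS]expR0 ler_expR mulr_ge0 ?expR_ge0.
have pub := profile_trajectory ou b0.
have iub := integrable_trajectory b0.
have Mb1 := scaled_mass_le_total b0.
have Mb2 := total_mass_le b0.
have Mb3 := scaled_mass_le b0.
have Mb0 : 0 <= scaled_mass b by apply: le_trans (scaled_mass_ge b0).
set Mb := scaled_mass b in Mb1 Mb2 Mb3 Mb0.
pose psi y := expR (m * b) * u b y - Mb * heat_kernel b y.
have iKb : mu.-integrable setT (fun y => (heat_kernel b y)%:E).
  have := integrable_heat_kernel [tuple 0 | i < d] b0.
  by apply: eq_integrable => // y _; rewrite heat_kernel_tsubC tsub0.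
have iA : mu.-integrable setT (EFin \o (fun y => expR (m * b) * u b y)).
  exact: (integrableZl measurableT _ iub).
have iB : mu.-integrable setT (EFin \o (fun y => Mb * heat_kernel b y)).
  exact: (integrableZl measurableT _ iKb).
have ipsi : mu.-integrable setT (EFin \o psi).
  exact: (integrableB measurableT iA iB).
have psi0 : \int[mu]_y psi y = 0.
  rewrite RintegralB // (RintegralZl _ measurableT iub) (RintegralZl _
    measurableT iKb).
  have -> : \int[mu]_y heat_kernel b y = 1.
    rewrite /Rintegral -[RHS](_ : fine 1%:E = 1) // -(integral_heat_kernel
      [tuple 0 | i < d] b0).
    by congr fine; apply: eq_integral => y _; rewrite heat_kernel_tsubC tsub0.
  by rewrite mulr1 subrr.
have e20 : 0 < ep / (2 * D) by rewrite divr_gt0 // mulr_gt0.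
have [S S0 hS] := mean_zero_decay e20 ipsi psi0.
exists (2 * b + S) => [|t x tbS]; first by lra.
pose s := t - b.
have s0 : 0 < s by rewrite /s; lra.
have bt : b < t by lra.
have t0 : 0 < t by lra.
have Ss : S <= s by rewrite /s; lra.
have t2s : t <= 2 * s by rewrite /s; lra.
pose p := P s (u b) x.
pose K := heat_kernel t x.
have p0 : 0 <= p by rewrite profile_ge0 //; exact: profile_heat.
have K0 : 0 <= K by exact: heat_kernel_ge0.
have tsd : t `^ (d%:R / 2) <= D * s `^ (d%:R / 2).
  rewrite /D -powRM ?(ltW s0) //; apply: ge0_ler_powR;
    rewrite ?nnegrE ?divr_ge0 //; lra.
(* [P s psi], by the semigroup law for the kernel: [P s K_b = K_t] *)
have Psi : \int[mu]_y (heat_kernel s (tsub x y) * psi y) =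
    expR (m * b) * p - Mb * K.
  have i1 := integrable_heat_profile x s0 pub.
  have iK : mu.-integrable setT (fun y => (heat_kernel s (tsub x y) *
    heat_kernel b y)%:E).
    exact: integrable_heat_L1.
  under eq_Rintegral do rewrite /psi mulrBr mulrCA [X in _ - X]mulrCA.
  rewrite RintegralB //; last 2 first.
  - exact: (integrableZl measurableT _ i1).
  - exact: (integrableZl measurableT _ iK).
  rewrite (RintegralZl _ measurableT i1) (RintegralZl _ measurableT iK).
  congr (_ - _ * _).
  have := integral_heat_kernelM x [tuple 0 | i < d] s0 b0.
  rewrite /s subrK tsub0 => hE.
  rewrite /Rintegral -[RHS]/(fine (heat_kernel t x)%:E) -hE.
  by congr fine; apply: eq_integral => y _; rewrite tsub0.
have up : expR (m * t) * u t x <= ka * (expR (m * b) * p).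
  have := restart_upper blf ou d1 pphi du phiM' M0 x b0 bt.
  move=> /(ler_wpM2l (expR_ge0 (m * t))) /le_trans; apply.
  have e : expR (m * t) * expR (- (m * (t - b)) + C * expR (- (m * b))) = ka *
    expR (m * b).
    by rewrite /ka -!expRD; congr expR; ring.
  by rewrite [leLHS]mulrA e -mulrA.
have lo : expR (m * b) * p <= expR (m * t) * u t x.
  have := restart_lower blf ou pphi du x b0 bt.
  move=> /(ler_wpM2l (expR_ge0 (m * t))); apply: le_trans.
  by rewrite mulrA -expRD (_ : m * t + _ = m * b) //; ring.
have sp : s `^ (d%:R / 2) * (expR (m * b) * p) <= Mb.
  have ub : (\int[mu]_y (u b y)%:E <= (expR (- (m * b)) * Mb)%:E)%E.
    by rewrite integral_trajectoryE.
  have := heat_decay x s0 pub ub; rewrite -/p => hp.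
  have := ler_wpM2l (expR_ge0 (m * b)) hp.
  move=> /(ler_wpM2l (powR_ge0 s (d%:R / 2))) /le_trans; apply.
  have -> : s `^ (d%:R / 2) * (expR (m * b) *
      ((4 * pi * s) `^ (- (d%:R / 2)) * (expR (- (m * b)) * Mb))) =
      (s `^ (d%:R / 2) * (4 * pi * s) `^ (- (d%:R / 2))) *
      (expR (m * b) * expR (- (m * b))) * Mb by ring.
  by rewrite -expRD subrr expR0 mulr1 ler_piMl // heat_peak_scaled_le1.
have tK : t `^ (d%:R / 2) * K <= 1 by exact: heat_kernel_scaled_le.
have := hS s x Ss; rewrite Psi -/K.
set A := expR (m * b) * p in up lo sp *; set w := expR (m * t) * u t x in up lo
  *.
set Tt := t `^ _ in tsd tK *; set St := s `^ _ in tsd sp * => hpsi.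
have Tt0 : 0 <= Tt by exact: powR_ge0.
have A0 : 0 <= A by rewrite mulr_ge0 ?expR_ge0.
have split3 : `|w - total_mass * K| <=
    (ka - 1) * A + `|A - Mb * K| + (total_mass - Mb) * K.
  have -> : w - total_mass * K = (w - A) + (A - Mb * K) - (total_mass - Mb) * K
    by ring.
  apply: (le_trans (ler_normB _ _)); apply: lerD.
    apply: (le_trans (ler_normD _ _)); rewrite lerD2r ger0_norm ?subr_ge0 //.
    by rewrite mulrBl mul1r lerD2r.
  by rewrite ger0_norm // mulr_ge0 // subr_ge0.
apply: (le_trans (ler_wpM2l Tt0 split3)).
have kae : (ka - 1) * Mb <= e1 * (C * M).
  by apply: ler_pM => //; rewrite subr_ge0.
have b1 : Tt * ((ka - 1) * A) <= D * (e1 * (C * M)).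
  apply: (@le_trans _ _ (D * St * ((ka - 1) * A))).
    by apply: ler_wpM2r => //; rewrite mulr_ge0 // subr_ge0.
  rewrite -mulrA ler_wpM2l ?(ltW D0) // mulrCA.
  by apply: le_trans kae; rewrite ler_wpM2l // subr_ge0.
have b2 : Tt * `|A - Mb * K| <= ep / 2.
  apply: (@le_trans _ _ (D * St * `|A - Mb * K|)); first by apply: ler_wpM2r.
  have := ler_wpM2l (ltW D0) hpsi; rewrite mulrA => /le_trans; apply.
  by rewrite le_eqVlt; apply/orP; left; apply/eqP; field; rewrite gt_eqF.
have b3 : Tt * ((total_mass - Mb) * K) <= e1 * (C * M).
  apply: le_trans kae; rewrite mulrCA.
  apply: (@le_trans _ _ (total_mass - Mb)); first by rewrite ler_piMr //
    subr_ge0.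
  by rewrite mulrBl mul1r lerD2r.
have b4 : D * (e1 * (C * M)) + e1 * (C * M) <= ep / 2.
  have -> : D * (e1 * (C * M)) + e1 * (C * M) = ep / 2 *
     ((D * (C * M) + C * M) / (D * (C * M) + C * M + 1)).
    rewrite /e1; field; apply/eqP => h; move: den0.
    by rewrite (_ : D * (C * M) + C * M + 1 = 0) ?mulr0 ?ltxx.
  rewrite ler_piMr ?divr_ge0 ?(ltW ep0) // ler_pdivrMr; lra.
by rewrite !mulrDr; lra.
Qed.

End asymptotics.

(** * Data with values in [0, 1] almost everywhere *)

Section clamping.
Context {R : realType} {d : nat}.
Local Notation T := (d.-tuple R).
Local Notation mu := (lebesgue_tuple R d).

(** The data lies in [0, 1] almost everywhere only; changing it on a null set
    to a function with values in [0, 1] changes neither convolutions nor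
    norms. *)
Definition clamp (phi : T -> R) (x : T) : R := Num.max 0 (Num.min 1 (phi x)).

Variable phi : T -> R.
Hypotheses (iphi : mu.-integrable setT (EFin \o phi))
  (phi01 : {ae mu, forall x, 0 <= phi x <= 1}).

Let mphi : measurable_fun setT phi.
Proof. by have /measurable_int/measurable_EFinP := iphi. Qed.

Lemma profile_clamp : profile (clamp phi).
Proof.
split.
  apply: measurable_maxr; first exact: measurable_cst.
  by apply: measurable_minr => //; exact: measurable_cst.
by move=> x; rewrite le_max lexx /= ge_max ler01 ge_min lexx.
Qed.

Lemma ae_clamp : {ae mu, forall x, clamp phi x = phi x}.
Proof.
apply: filterS phi01 => x /andP[p0 p1].
by rewrite /clamp (min_r p1) (max_r p0).
Qed.

Lemma convolution_clamp t x : 0 < t ->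
  convolution (heat_kernel t) (clamp phi) x = convolution (heat_kernel t) phi x.
Proof.
move=> t0; congr fine; apply: ae_eq_integral => //.
- by have /measurable_int := integrable_heat_profile x t0 profile_clamp.
- by have /measurable_int := integrable_heat_L1 x t0 iphi.
- by apply: filterS ae_clamp => y cE _; rewrite cE.
Qed.

Lemma mild_solution_clamp q u : mild_solution q phi u ->
  mild_solution q (clamp phi) u.
Proof.
move=> [m1 u01 u0 uE]; split => //.
  by apply: filterS2 u0 ae_clamp => x -> ->.
by move=> t x t0; rewrite uE // convolution_clamp.
Qed.

Lemma integral_clamp : (\int[mu]_x (clamp phi x)%:E = 'N[mu]_1[EFin \o phi])%E.
Proof.
rewrite Lnorm1; apply: ae_eq_integral => //.
- by apply/measurable_EFinP; case: profile_clamp.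
- by apply: measurableT_comp => //; exact: measurable_int iphi.
- apply: filterS2 ae_clamp phi01 => x cE /andP[p0 _] _.
  by rewrite cE /= ger0_norm.
Qed.

End clamping.

(** * Convergence in the essential supremum norm *)

Lemma Lnorm_infty_le d0 (X : measurableType d0) (R : realType)
    (mu : {measure set X -> \bar R}) (h : X -> R) (c : R) :
  0 <= c -> (forall x, `|h x| <= c) -> ('N[mu]_+oo[EFin \o h] <= c%:E)%E.
Proof.
move=> c0 hc; rewrite unlock /Lnorm; case: ifP => _; last by rewrite lee_fin.
by apply/ess_supP; apply: aeW => x; rewrite /= lee_fin.
Qed.

Lemma cvge_ge0_eps (R : realType) (g : R -> \bar R) :
  (forall t : R, 0 < t -> (0 <= g t)%E) ->
  (forall ep : R, 0 < ep -> exists2 t0 : R, 0 < t0 &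
     forall t, t0 <= t -> (g t <= ep%:E)%E) ->
  g t @[t --> +oo] --> 0%E.
Proof.
move=> g0 gep.
have near_ge (P : R -> Prop) (t0 : R) : (forall t, t0 <= t -> P t) ->
    \forall t \near +oo, P t.
  by move=> H; exists t0; split; [exact: num_real|move=> t /ltW /H].
apply/fine_cvgP; split.
  have [t0 t00 ht] := gep 1 ltr01.
  apply: (near_ge _ t0) => t tt; rewrite ge0_fin_numE ?g0 //.
    exact: le_lt_trans (ht t tt) (ltry 1).
  exact: lt_le_trans tt.
apply/cvgrPdist_le => ep ep0; have [t0 t00 ht] := gep ep ep0.
apply: (near_ge _ t0) => t tt; have t_gt0 : 0 < t by exact: lt_le_trans tt.
rewrite sub0r normrN /= ger0_norm; last by rewrite fine_ge0 ?g0.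
rewrite -lee_fin fineK ?ht // ge0_fin_numE ?g0 //.
exact: le_lt_trans (ht t tt) (ltry ep).
Qed.

Theorem theorem1p2 (R : realType) :
  exists C : nat -> nat -> R -> R,
  forall (d : nat) (hd : (1 <= d)%N)
    (q : nat -> R) (qbar : R) (p : nat)
    (hq0 : forall k, (1 <= k)%N -> 0 <= q k)
    (hq1 : (fun n => \sum_(1 <= k < n) q k) @ \oo --> (1 : R))
    (hqbar : (fun n => \sum_(1 <= k < n) k%:R * q k) @ \oo --> qbar)
    (hqbar1 : 1 < qbar)
    (hp : (2 <= p)%N) (hqp : q p != 0)
    (hpmin : forall k, (2 <= k < p)%N -> q k = 0)
    (phi : d.-tuple R -> R)
    (hphi : (lebesgue_tuple R d).-integrable setT (EFin \o phi))
    (hphi01 : {ae lebesgue_tuple R d, forall x, 0 <= phi x <= 1})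
    (u : R -> d.-tuple R -> R)
    (hu : mild_solution q phi u),
  (forall (t : R) (x : d.-tuple R), 0 < t ->
     expR (- ((1 - q 1%N) * t)) * convolution (heat_kernel t) phi x <= u t x /\
     u t x <= C d p (fine ('N[lebesgue_tuple R d]_1[EFin \o phi])%E) *
              (expR (- ((1 - q 1%N) * t)) * convolution (heat_kernel t) phi x)) /\
  (exists Cphi : R,
     [/\ 0 <= Cphi,
         ~ {ae lebesgue_tuple R d, forall x, phi x = 0} -> 0 < Cphi &
         ((t `^ (d%:R / 2))%:E *
           'N[lebesgue_tuple R d]_+oo[
             EFin \o (fun x : d.-tuple R =>
               (expR (t * (1 - q 1%N)) * u t x - Cphi * heat_kernel t x)%R)])%E
           @[t --> +oo] --> 0%E]).
Proof.
exists (fun _ _ N => upper_const N).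
move=> d hd q qbar p hq0 hq1 hqbar hqbar1 hp hqp hpmin phi hphi hphi01 u hu.
have bl := branching_law_reaction hq0 hq1 hp hqp.
have pc := profile_clamp hphi.
have [ou du] := mild_solution_duhamel bl (mild_solution_clamp hphi hphi01 hu).
set N1 := 'N[lebesgue_tuple R d]_1[EFin \o phi]%E.
have N1fin : N1 \is a fin_num.
  rewrite /N1 Lnorm1; apply: integrable_fin_num => //; exact: integrable_abse.
have cM : (\int[lebesgue_tuple R d]_y (clamp phi y)%:E = (fine N1)%:E)%E.
  by rewrite integral_clamp // fineK.
have cM' : (\int[lebesgue_tuple R d]_y (clamp phi y)%:E <= (fine N1)%:E)%E by
  rewrite cM.
have M0 : 0 <= fine N1 by rewrite fine_ge0 // Lnorm_ge0.
split.
  move=> t x t0; rewrite -(convolution_clamp hphi hphi01) //; split.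
    by have := duhamel_lower bl ou pc (lexx 0) du x t0; rewrite !subr0.
  exact: (trajectory_upper bl ou hd pc du cM' M0).
have Cge := total_mass_ge bl ou hd pc du cM M0.
exists (total_mass (1 - q 1%N) u); split.
- exact: le_trans Cge.
- move=> phi0; apply: lt_le_trans Cge; rewrite lt_neqAle M0 andbT.
  apply/eqP => /esym N10; apply: phi0.
  have : (\int[lebesgue_tuple R d]_x `|(EFin \o phi) x| = 0)%E.
    by rewrite -Lnorm1 -/N1 -(fineK N1fin) N10.
  move=> /(ae_eq_integral_abs _ measurableT (measurable_int _ hphi)).
  by apply: filterS => x /(_ I) [].
- apply: cvge_ge0_eps => [t t0|ep ep0].
    by rewrite mule_ge0 ?lee_fin ?powR_ge0 ?Lnorm_ge0.
  have [t0 t00 ht] := asymptotic_profile bl ou hd pc du cM M0 ep0.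
  exists t0 => // t tt; have tp : 0 < t by exact: lt_le_trans tt.
  have Tt0 : 0 < t `^ (d%:R / 2) by rewrite powR_gt0.
  apply: (@le_trans _ _ ((t `^ (d%:R / 2))%:E * (ep / t `^ (d%:R / 2))%:E)%E).
    rewrite lee_wpmul2l ?lee_fin ?powR_ge0 //; apply: Lnorm_infty_le.
      by rewrite divr_ge0 // ltW.
    by move=> x; rewrite ler_pdivlMr // mulrC [t * _]mulrC; exact: ht.
  by rewrite -EFinM lee_fin mulrC divfK ?gt_eqF.
Qed.
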